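(* Let $(G,S)$ be a right-angled Artin group. (1) For any cyclically reduced element $w$ of $G$, $S_w=\bigcap_{p\in \mathrm{Prim}(w)}S_p$, and this set generates the convex subgroup $\widetilde 1^{w}=\bigcap_{p\in \mathrm{Prim}(w)}\widetilde 1^{p}$; moreover the median subgroup $H_w=Z_G(w)\cap X_{w,1}$ is Abelian, freely generated (as an Abelian group) by $\mathrm{Prim}(w)$, and contained in the center of $Z_G(w)$. (2) For any $w\in G$ and $a\in X_w$, the centralizer $Z_G(w)$ is the direct product of the right-angled Artin group generated by $\bigcap_{p\in \mathrm{Prim}(w)}a\,S_{a^{-1}pa}\,a^{-1}$ and the free Abelian group generated by $\mathrm{Prim}(w)$. In particular, $Z_G(w)$ is a right-angled Artin group. (3) The center $Z(G)$ of $G$ is the free Abelian group generated by the (possibly empty) set $\{s\in S: st=ts \text{ for all } t\in S\}$.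
   Context: $(G,S)$ is a right-angled Artin group: $S\subseteq G$ is a (possibly infinite) generating set of the group $G$ with $S\cap S^{-1}=\emptyset$, and $G$ has the presentation $\langle S\,;\,[s,t]=1$ for those $s\neq t$ in $S$ with $st=ts$ in $G\rangle$. Let $l$ be the word length on $G$ with respect to $S\cup S^{-1}$. Write $x\subset y$ iff $l(x)+l(x^{-1}y)=l(y)$; this is a partial order with least element $1$, in which any two elements have a greatest lower bound $x\cap y$. Elements $x,y$ are orthogonal, $x\perp y$, if $x\cap y=1$ and $x,y$ have a least upper bound for $\subset$ (equivalently, a common upper bound). Put $[x,y]=\{z\in G: x^{-1}z\subset x^{-1}y\}$ and $Y(x,y,z)=x(x^{-1}y\cap x^{-1}z)$, the unique element of $[x,y]\cap[y,z]\cap[z,x]$. A subset $I$ is convex if $[x,y]\subseteq I$ for all $x,y\in I$; the convex closure of a set is the smallest convex set containing it. A subgroup $H$ is median if $Y(x,y,z)\in H$ for all $x,y,z\in H$. An element $w$ is cyclically reduced if $w\cap w^{-1}=1$. For $w\in G$ put $\varphi_w(x)=Y(wx,x,w^{-1}x)$ and $X_w=\varphi_w(G)=\{x\in G: x^{-1}wx \text{ is cyclically reduced}\}$. For $a\in X_w$ let $X_{w,a}$ be the convex closure of $\{w^na:n\in\mathbb Z\}$. For a cyclically reduced $v$ put $H_v=Z_G(v)\cap X_{v,1}$, where $Z_G(v)$ is the centralizer. An element $w\neq1$ is primitive if for some (equivalently, for all) $a\in X_w$ the group $H_{a^{-1}wa}$ is cyclic, generated by $a^{-1}wa$. Every $w\in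 G$ can be written, uniquely up to order of the factors, as $w=\prod_{i=1}^n p_i^{m_i}$ with $p_i$ primitive, $m_i\ge1$, and $a^{-1}p_ia\perp a^{-1}p_ja$ for all $i\neq j$ and all $a\in X_w$; $\mathrm{Prim}(w)=\{p_1,\dots,p_n\}$ (so $\mathrm{Prim}(1)=\emptyset$). For $w\in G$: $S_w=\{s\in S: s\perp w\}$. Write $x\preceq_w y$ iff $y\in[x,wy]$ (a preorder); $\widetilde 1^{w}$ is the class of $1$ for the equivalence relation $x\sim_w y\iff(x\preceq_wy\text{ and }y\preceq_wx)$; it equals $\{x\in G:x\perp w\}$ and is a convex subgroup. An intersection over an empty index set of subsets of $S$ (resp. of $G$), or of sets $aS_{a^{-1}pa}a^{-1}$, is understood to be $S$ (resp. $G$, resp. $aSa^{-1}$). *)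

(* Defs.v *)
From mathcomp Require Import all_boot ssrint.
From mathcomp Require Import boolp classical_sets.
Set Implicit Arguments. Unset Strict Implicit. Unset Printing Implicit Defensive.
Local Open Scope classical_set_scope.
Local Open Scope group_scope.

Section Groups.
Variable G : groupType.
Implicit Types (A B H P : set G) (x y z : G).

Definition is_subgroup H : Prop :=
  [/\ H 1, forall x y, H x -> H y -> H (x * y) & forall x, H x -> H x^-1].

Definition generated A : set G := smallest is_subgroup A.

Definition centralizer x : set G := [set y | commute x y].

Definition center H : set G := [set z | H z /\ forall x, H x -> commute z x].

Definition zexpg x (n : int) : G :=
  match n with Posz k => x ^+ k | Negz k => x ^- k.+1 end.

Definition is_cyclic_gen H x : Prop := H = [set zexpg x n | n in [set: int]].

(* H is free Abelian with basis P (P may be infinite). *)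
Definition is_free_abelian H P : Prop :=
  [/\ H = generated P,
      forall x y, H x -> H y -> commute x y &
      forall (n : nat) (p : 'I_n -> G) (m : 'I_n -> int),
        injective p -> (forall i, P (p i)) ->
        \prod_(i < n) zexpg (p i) (m i) = 1 -> forall i, m i = Posz 0].

Definition is_direct_product H A B : Prop :=
  [/\ is_subgroup A /\ is_subgroup B,
      forall x y, A x -> B y -> commute x y,
      A `&` B = [set 1] &
      H = [set x * y | x in A & y in B]].

(* A letter (s, false) stands for s, and (s, true) for the formal inverse of s. *)
Definition word := seq (G * bool).

Definition eval_word (u : word) : G :=
  \prod_(c <- u) (if c.2 then c.1^-1 else c.1).

Definition word_over (S : set G) (u : word) : Prop :=
  forall c, c \in u -> S c.1.

(* Equality in the group presented by < S ; R >. *)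
Inductive pres_eq (S : set G) (R : set word) : word -> word -> Prop :=
| pres_refl u : pres_eq S R u u
| pres_sym u v : pres_eq S R u v -> pres_eq S R v u
| pres_trans u v t : pres_eq S R u v -> pres_eq S R v t -> pres_eq S R u t
| pres_cancel u s b v :
    S s -> pres_eq S R (u ++ [:: (s, b); (s, ~~ b)] ++ v) (u ++ v)
| pres_relator u r v : R r -> pres_eq S R (u ++ r ++ v) (u ++ v).

Definition has_presentation H (S : set G) (R : set word) : Prop :=
  H = generated S /\
  forall u, word_over S u -> (eval_word u = 1 <-> pres_eq S R u [::]).

Definition commutation_relators (S : set G) : set word :=
  [set r | exists s t, [/\ S s, S t, s <> t, commute s t &
     r = [:: (s, true); (t, true); (s, false); (t, false)]]].

(* The subgroup H of G, with generating set S, is a right-angled Artin group;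
   for the pair (G, S) itself take H = [set: G]. *)
Definition is_raag H (S : set G) : Prop :=
  [/\ forall s, S s -> ~ S s^-1 &
      has_presentation H S (commutation_relators S)].

End Groups.

Section Median.
Variables (G : groupType) (S : set G).
Implicit Types (w x y z a p : G) (A I H : set G).

Definition is_word_length x (n : nat) : Prop :=
  (exists u, [/\ word_over S u, eval_word u = x & size u = n]) /\
  (forall u, word_over S u -> eval_word u = x -> (n <= size u)%N).

(* The default value 0 is irrelevant when S generates G. *)
Definition len x : nat := xget 0%N [set n | is_word_length x n].

Definition prec x y : Prop := (len x + len (x^-1 * y))%N = len y.

Definition is_meet x y m : Prop :=
  [/\ prec m x, prec m y & forall z, prec z x -> prec z y -> prec z m].

Definition is_join x y j : Prop :=
  [/\ prec x j, prec y j & forall z, prec x z -> prec y z -> prec j z].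

(* In a right-angled Artin group the meet always exists and is unique. *)
Definition meet x y : G := xget 1 [set m | is_meet x y m].

Definition orth x y : Prop := meet x y = 1 /\ exists j, is_join x y j.

Definition interval x y : set G := [set z | prec (x^-1 * z) (x^-1 * y)].

Definition median x y z : G := x * meet (x^-1 * y) (x^-1 * z).

Definition is_convex I : Prop :=
  forall x y, I x -> I y -> interval x y `<=` I.

Definition convex_closure A : set G := smallest is_convex A.

Definition is_median_subgroup H : Prop :=
  is_subgroup H /\
  forall x y z, H x -> H y -> H z -> H (median x y z).

Definition cyclically_reduced w : Prop := meet w w^-1 = 1.

Definition phi w x : G := median (w * x) x (w^-1 * x).

Definition X w : set G := range (phi w).

Definition Xcomp w a : set G :=
  convex_closure [set zexpg w n * a | n in [set: int]].

Definition Hsub w : set G := centralizer w `&` Xcomp w 1.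

(* Here x ^ a is the conjugate a^-1 * x * a. *)
Definition primitive w : Prop :=
  w <> 1 /\ exists a, X w a /\ is_cyclic_gen (Hsub (w ^ a)) (w ^ a).

Definition prim_decomposition w (n : nat) (p : 'I_n -> G) (m : 'I_n -> nat)
    : Prop :=
  [/\ w = \prod_(i < n) p i ^+ m i,
      forall i, primitive (p i),
      forall i, (0 < m i)%N &
      forall i j, i <> j -> forall a, X w a -> orth (p i ^ a) (p j ^ a)].

(* The decomposition is unique up to the order of the factors, so that this is
   the set of the factors of any decomposition. *)
Definition Prim w : set G :=
  [set q | exists (n : nat) (p : 'I_n -> G) (m : 'I_n -> nat),
     prim_decomposition w p m /\ exists i, q = p i].

Definition Sorth w : set G := [set s | S s /\ orth s w].

Definition preceq w x y : Prop := interval x (w * y) y.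

Definition simw w x y : Prop := preceq w x y /\ preceq w y x.

Definition tilde1 w : set G := [set x | simw w x 1].

End Median.

Definition conj_set (G : groupType) (a : G) (A : set G) : set G :=
  [set a * s * a^-1 | s in A].

(* Main.v *)
(* Letting letters act on reduced words by left multiplication and cancellation
   shows that reduced words are unique up to swapping adjacent independent
   letters.  Hence x is below y iff a reduced word of x extends to one of y, meets
   are greatest common prefixes, and x and y are orthogonal iff each letter of x is
   independent of each letter of y.

   Let w be cyclically reduced.  If w ^ x is cyclically reduced too and x <> 1, then
   some first letter of x starts w or w^-1, or is independent of w; by induction
   x = y t with t orthogonal to w and y in X_{w,1}.  Thus Z(w) is the product of
   H_w, the elements of Z(w) with letters in the support of w, and of <S_w>.
   Projecting to the free monoids on pairs of dependent letters shows that H_w is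
   Abelian and that meets of elements of H_w lying below powers of w stay in H_w.
   So a shortest nontrivial prefix p of w commuting with w is primitive and splits
   off orthogonally, w = p^m w', and induction on the length describes Prim(w) and
   H_w.  A general w is conjugated into this case. *)

Require Import Defs.
From mathcomp Require Import all_boot ssrint zify.
From mathcomp Require Import boolp classical_sets.
Set Implicit Arguments. Unset Strict Implicit. Unset Printing Implicit Defensive.
Local Open Scope classical_set_scope.
Local Open Scope group_scope.

(** * Reduced words *)

Section Words.
Variable G : groupType.
Implicit Types (c d e : (G * bool)%type) (u v x : word G) (A : set G).

(** The chosen reduced word of an element matters only up to [teq]; describing [teq] by projections,
    and not as the relation generated by swaps, turns cancellation and the extraction of a first
    letter into computations on lists. Whether a product has cancellation is decided by its length,
    so most factorisation arguments become arithmetic with the triangle inequality.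

    Two features of the definitions shape the rest. [primitive] asks for some base point in X_w and
    [prim_decomposition] for all of them, so conjugation between cyclically reduced elements has to
    preserve supports and not only lengths. And X_{w,1} is a convex closure, which is traded for a
    condition on supports once an element commutes with w. The projection argument for meets needs
    elements below a power of w; therefore the median property of all of H_w comes only after the
    decomposition, with meets taken factor by factor. *)

Definition indep c d := (c.1 != d.1) && (c.1 * d.1 == d.1 * c.1).
Definition linv c : G * bool := (c.1, ~~ c.2).
Definition lval c : G := if c.2 then c.1^-1 else c.1.

Lemma indepC c d : indep c d = indep d c.
Proof. by rewrite /indep eq_sym; congr (_ && _); rewrite eq_sym. Qed.

Lemma indep_irr c : indep c c = false.
Proof. by rewrite /indep eqxx. Qed.

Lemma indepVl c d : indep (linv c) d = indep c d. Proof. by []. Qed.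
Lemma indepVr c d : indep c (linv d) = indep c d. Proof. by []. Qed.

Lemma linvK c : linv (linv c) = c.
Proof. by case: c => s b; rewrite /linv negbK. Qed.

Lemma linv_neq c : (linv c == c) = false.
Proof. by case: c => s []; rewrite /linv xpair_eqE /= andbF. Qed.

Lemma lvalV c : lval (linv c) = (lval c)^-1.
Proof. by case: c => s []; rewrite /lval /= ?invgK. Qed.

Lemma indep_commute c d : indep c d -> commute (lval c) (lval d).
Proof.
case: c d => [s b] [t b'] /andP[_ /= /eqP st]; rewrite /lval /=.
have sVt : commute s t by [].
case: b b' => [] [] //; [| | exact: commuteV].
  by apply: commuteV; apply: commute_sym; apply: commuteV; apply: commute_sym.
by apply: commute_sym; apply: commuteV; apply: commute_sym.
Qed.

Lemma eval_cons c u : eval_word (c :: u) = lval c * eval_word u.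
Proof. by rewrite /eval_word big_cons. Qed.

Lemma eval_nil : eval_word [::] = 1 :> G.
Proof. by rewrite /eval_word big_nil. Qed.

Lemma eval_cat u v : eval_word (u ++ v) = eval_word u * eval_word v.
Proof. by rewrite /eval_word big_cat. Qed.

(** The first [c] is removed if it can be swapped to the front. [None] means that another letter
    dependent on [c] precedes it, or that [c] does not occur. *)
Fixpoint pull c u : option (word G) :=
  match u with
  | [::] => None
  | d :: u' => if d == c then Some u'
               else if indep c d then omap (cons d) (pull c u') else None
  end.

Definition proj c d u := [seq e <- u | (e == c) || (e == d)].

(* Equality in the trace monoid: by Cartier and Foata, two words agree up to
   swapping adjacent independent letters iff all these projections agree. *)
Definition teq u v := forall c d, ~~ indep c d -> proj c d u = proj c d v.

Fixpoint red u : bool :=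
  if u is c :: u' then ~~ pull (linv c) u' && red u' else true.

Lemma teq_refl u : teq u u. Proof. by []. Qed.
Lemma teq_sym u v : teq u v -> teq v u. Proof. by move=> h c d /h ->. Qed.
Lemma teq_trans u v x : teq u v -> teq v x -> teq u x.
Proof. by move=> h k c d cd; rewrite (h _ _ cd) (k _ _ cd). Qed.
Lemma teq_cat u u' v v' : teq u u' -> teq v v' -> teq (u ++ v) (u' ++ v').
Proof.
by move=> h k c d cd; rewrite /proj !filter_cat; congr (_ ++ _); [exact: h|exact: k].
Qed.
Lemma teq_cons c u v : teq u v -> teq (c :: u) (c :: v).
Proof. exact: (@teq_cat [:: c] [:: c]). Qed.
Lemma teq_consI c u v : teq (c :: u) (c :: v) -> teq u v.
Proof.
move=> h d e de; move: (h d e de); rewrite /proj /=.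
by case: ifP => // _ [].
Qed.

(** The pair [(c, c)] is dependent, and its projection counts the occurrences of [c]. *)
Lemma teq_perm u v : teq u v -> perm_eq u v.
Proof.
move=> h; apply/allP => c _ /=; apply/eqP.
have:= h c c; rewrite indep_irr /proj => /(_ isT) /(congr1 size).
by rewrite !size_filter; under eq_count do rewrite orbb;
  under [in RHS]eq_count do rewrite orbb.
Qed.

Lemma teq_size u v : teq u v -> size u = size v.
Proof. by move/teq_perm/perm_size. Qed.

Lemma teq_mem u v : teq u v -> u =i v.
Proof. by move/teq_perm/perm_mem. Qed.

Lemma teq_swap c d u : indep c d -> teq (c :: d :: u) (d :: c :: u).
Proof.
move=> cd e f ef; rewrite /proj /=.
have [ec|ec] := boolP ((c == e) || (c == f)); last by case: ifP.
have [ed|//] := boolP ((d == e) || (d == f)).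
case/orP: ec ed ef cd => /eqP-> /orP[]/eqP->; rewrite ?indep_irr ?[indep f e]indepC //.
  by move=> /negbTE->.
by move=> /negbTE->.
Qed.

Lemma pull_teq c u u' : pull c u = Some u' -> teq u (c :: u').
Proof.
elim: u u' => //= d u IH u'; case: eqP => [-> [<-]//|_].
case: ifP => // cd; case: pull IH => //= u1 IH [<-].
apply: teq_trans (teq_swap _ _); last by rewrite indepC.
by apply: teq_cons; exact: IH.
Qed.

(** A letter dependent on [c] cannot precede the first [c], as it would head the projection to the
    pair that it forms with [c]. The pair [(c, c)] ensures that [c] occurs. *)
Lemma pull_proj c u :
  (forall e, ~~ indep c e -> ohead (proj c e u) = Some c) -> pull c u.
Proof.
elim: u => [|d u IH] h /=; first by have := h c; rewrite indep_irr => /(_ isT).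
case: eqP => // dc; case: ifP => [cd|/negbT cd]; last first.
  by have := h d cd; rewrite /proj /= eqxx orbT => -[].
suff: pull c u by case: pull.
apply: IH => e ce; have := h e ce; rewrite /proj /=.
move/eqP/negbTE: dc => ->; case: eqP => // de.
by move: ce; rewrite -de cd.
Qed.

(** Extraction depends on the trace and not on the word: projections see that [c] comes first, and
    cancelling it leaves the same remainder up to [teq]. *)
Lemma pull_teq_cons c u v :
  teq u (c :: v) -> exists2 u', pull c u = Some u' & teq u' v.
Proof.
move=> h; have : pull c u.
  by apply: pull_proj => e ce; rewrite (h _ _ ce) /proj /= eqxx.
case E: (pull c u) => [u'|//] _; exists u' => //.
by apply: (@teq_consI c); apply: teq_trans h; apply: teq_sym; apply: pull_teq.
Qed.

Lemma teq_pull c u v : teq u v -> isSome (pull c u) = isSome (pull c v).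
Proof.
have H x y : teq x y -> pull c x -> pull c y.
  move=> h; case E: (pull c x) => [x'|//] _.
  have [y' -> //] : exists2 y', pull c y = Some y' & teq y' x'.
  by apply: pull_teq_cons; apply: teq_trans (pull_teq E); apply: teq_sym.
by move=> h; apply/idP/idP; apply: H => //; apply: teq_sym.
Qed.

Lemma pull_eval c u u' :
  pull c u = Some u' -> eval_word u = lval c * eval_word u'.
Proof.
elim: u u' => //= d u IH u'; case: eqP => [-> [<-]|_]; first exact: eval_cons.
case: ifP => // cd; case: pull IH => //= u1 IH [<-].
by rewrite !eval_cons (IH u1) // !mulgA (indep_commute cd).
Qed.

Lemma teq_eval u v : teq u v -> eval_word u = eval_word v.
Proof.
elim: u v => [|c u IH] v h; first by case: v h => // d v /teq_size.
have [v' E h'] := pull_teq_cons (teq_sym h).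
by rewrite (pull_eval E) eval_cons (IH v') //; apply: teq_sym.
Qed.

Lemma pull_cat c u v : pull c (u ++ v) =
  if pull c u is Some u' then Some (u' ++ v)
  else if all (indep c) u then omap (cat u) (pull c v) else None.
Proof.
elim: u => [|d u IH] /=; first by case: pull.
case: eqP => // _; case: (indep c d) => //=; rewrite IH.
case: (pull c u) => //=; case: all => //=; by case: (pull c v).
Qed.

Lemma pull_mem c u : pull c u -> c \in u.
Proof.
elim: u => //= d u IH; rewrite in_cons [c == d]eq_sym; case: eqP => //= _.
by case: (indep c d) => //; case: pull IH => //= u' ->.
Qed.

Lemma red_pull c u u' : red u -> pull c u = Some u' ->
  red u' /\ ~~ pull (linv c) u'.
Proof.
elim: u u' => //= d u IH u' /andP[du ru]; case: eqP => [dc [<-]|dc].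
  by rewrite ru -dc.
case: ifP => // cd; case E: (pull c u) => [u1|//] /= [<-].
have [r1 n1] := IH _ ru E; split=> /=; last first.
  have -> : d == linv c = false.
    by apply/negbTE/eqP => dE; move: cd; rewrite dE indepVr indep_irr.
  by rewrite indepVl cd; case: pull n1.
rewrite r1 andbT; apply: contra du => h.
rewrite (teq_pull _ (pull_teq E)) /=.
case: eqP => // _; rewrite indepVl indepC cd.
by case: pull h.
Qed.

Lemma teq_red u v : teq u v -> red u -> red v.
Proof.
elim: v u => //= c v IH u h ru.
have [u' E h'] := pull_teq_cons h.
have [ru' nu'] := red_pull ru E.
by rewrite -(teq_pull _ h') nu' (IH u').
Qed.

(** * Letters acting on reduced words *)

Definition act c u := if pull (linv c) u is Some u' then u' else c :: u.

Lemma act_teq c u v : teq u v -> teq (act c u) (act c v).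
Proof.
move=> h; rewrite /act; case E: (pull _ u) => [u'|]; last first.
  have := teq_pull (linv c) h; rewrite E; case: pull => // _.
  exact: teq_cons.
have [v' -> h'] : exists2 v', pull (linv c) v = Some v' & teq v' u'.
  by apply: pull_teq_cons; apply: teq_trans (pull_teq E); apply: teq_sym.
exact: teq_sym.
Qed.

Lemma act_red c u : red u -> red (act c u).
Proof.
move=> ru; rewrite /act; case E: pull => [u'|] /=; last by rewrite E.
by case: (red_pull ru E).
Qed.

Lemma act_eval c u : eval_word (act c u) = lval c * eval_word u.
Proof.
rewrite /act; case E: pull => [u'|] /=; last exact: eval_cons.
by rewrite (pull_eval E) lvalV mulVKg.
Qed.

(** Reducedness matters when [linv c] cancels a [c]: the remainder must not start with [linv c], or
    the second action would cancel again instead of restoring [c]. *)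
Lemma actK c u : red u -> teq (act c (act (linv c) u)) u.
Proof.
move=> ru; rewrite {2}/act linvK; case E: pull => [u'|].
  have [_ n] := red_pull ru E; rewrite /act; case: pull n => // _.
  by apply: teq_sym; apply: pull_teq.
by rewrite /act /= eqxx.
Qed.

(** A cancellation by one letter does not affect whether the other one cancels. [half] covers a
    letter [e] that does not cancel; if both cancel, the remainders are compared after putting
    [linv c] back in front. *)
Lemma act_comm c d u : indep c d -> teq (act c (act d u)) (act d (act c u)).
Proof.
have half e f v : indep e f -> pull (linv e) v = None ->
    teq (act e (act f v)) (act f (act e v)).
  move=> ef E; rewrite {4}/act E /act.
  have fe : indep f e by rewrite indepC.
  case F: (pull (linv f) v) => [v'|].
    rewrite /= indepVl fe F /=.
    case: eqP => [eE|_]; first by move: ef; rewrite eE indepVl indep_irr.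
    case E': (pull (linv e) v') => [v2|//].
    have : pull (linv e) v.
      rewrite (teq_pull _ (pull_teq F)) /= indepVr indepVl ef E'.
      by case: eqP.
    by rewrite E.
  rewrite /= !indepVl ef fe E F /=.
  case: eqP => [eE|_]; first by move: ef; rewrite eE indepVr indep_irr.
  case: eqP => [eE|_]; first by move: ef; rewrite eE indepVl indep_irr.
  exact: teq_swap.
move=> cd; have dc : indep d c by rewrite indepC.
case E: (pull (linv c) u) => [u1|]; last exact: half.
case F: (pull (linv d) u) => [u2|]; last by apply: teq_sym; exact: half.
rewrite {2 4}/act E F.
have h : teq (linv c :: u1) (linv d :: u2).
  by apply: (teq_trans _ (pull_teq F)); apply: teq_sym; apply: pull_teq.
have [u3 E3 h3] := pull_teq_cons h.
move: E3 => /=; case: eqP => [eE|_]; first by move: cd;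
  rewrite -indepVl eE indepVl indep_irr.
rewrite indepVl indepVr dc; case G1: (pull _ u1) => [u13|//] /= [E3].
have [u4 + _] := pull_teq_cons (teq_sym h).
move=> /=; case: eqP => [eE|_]; first by move: dc; rewrite -indepVl eE indepVl indep_irr.
rewrite indepVl indepVr cd; case G2: (pull _ u2) => [u24|//] _.
rewrite /act G1 G2.
apply/teq_sym/(@teq_consI (linv c)); rewrite E3.
exact: teq_trans h3 (pull_teq G2).
Qed.

Definition reduce x u := foldr act x u.

Lemma reduce_red x u : red x -> red (reduce x u).
Proof. by move=> rx; elim: u => //= c u; apply: act_red. Qed.

Lemma reduce_teq x y u : teq x y -> teq (reduce x u) (reduce y u).
Proof. by move=> h; elim: u => //= c u IH; apply: act_teq. Qed.

Lemma reduce_cat x u v : reduce x (u ++ v) = reduce (reduce x v) u.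
Proof. exact: foldr_cat. Qed.

Lemma reduce_eval x u : eval_word (reduce x u) = eval_word u * eval_word x.
Proof.
elim: u => [|c u IH] /=; first by rewrite eval_nil mul1g.
by rewrite act_eval IH eval_cons mulgA.
Qed.

Lemma reduce_id u : red u -> reduce [::] u = u.
Proof.
elim: u => //= c u IH /andP[h /IH ->]; rewrite /act.
by case: pull h.
Qed.

Lemma act_mem c u : {subset act c u <= c :: u}.
Proof.
move=> e; rewrite /act; case E: pull => [u'|] //= eu.
by rewrite in_cons (teq_mem (pull_teq E)) in_cons eu !orbT.
Qed.

Lemma reduce_mem u : {subset reduce [::] u <= u}.
Proof.
elim: u => //= c u IH e /act_mem; rewrite !in_cons => /orP[->//|/IH ->].
by rewrite orbT.
Qed.

Lemma act_size c u : (size (act c u) <= (size u).+1)%N.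
Proof.
rewrite /act; case E: pull => [u'|] //=.
by rewrite (teq_size (pull_teq E)) /= leqW.
Qed.

Lemma reduce_size u : (size (reduce [::] u) <= size u)%N.
Proof. by elim: u => //= c u IH; apply: leq_trans (act_size _ _) _. Qed.

Lemma size_reduce_red u : size (reduce [::] u) = size u -> red u.
Proof.
elim: u => //= c u IH; rewrite {1}/act; case E: pull => [u'|] /=.
  move=> h; have := reduce_size u; rewrite (teq_size (pull_teq E)) /= h.
  by rewrite ltnNge leqnSn.
by move=> [/IH ru]; rewrite ru andbT; rewrite reduce_id in E *; rewrite ?E.
Qed.

(** Van der Waerden's argument: the presented group acts on reduced words up to [teq]. Cancelling
    pairs act trivially by [actK], and commutators by [act_comm] together with [actK]. *)
Lemma pres_eq_reduce A u v : pres_eq A (commutation_relators A) u v ->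
  forall x, red x -> teq (reduce x u) (reduce x v).
Proof.
elim=> {u v} [u|u v _ IH|u v w _ IH1 _ IH2|u s b v _|u r v [s [t [_ _ /eqP st cst ->]]]] x rx //.
- by apply: teq_sym; apply: IH.
- by apply: teq_trans (IH1 _ rx) (IH2 _ rx).
- rewrite !reduce_cat; apply: reduce_teq => /=.
  exact: (@actK (s, b)) (reduce_red v rx).
rewrite !reduce_cat; apply: reduce_teq => /=.
have ry := reduce_red v rx; set y := reduce x v in ry *.
have ind b b' : indep (s, b) (t, b') by rewrite /indep /= st; apply/eqP.
apply: teq_trans (@actK (s, true) _ ry); apply: act_teq.
apply: teq_trans (@actK (t, true) _ (act_red _ ry)); apply: act_teq.
exact: act_comm.
Qed.

Lemma pres_eq_cat A R u u' v v' :
  pres_eq A R u u' -> pres_eq A R v v' -> pres_eq A R (u ++ v) (u' ++ v').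
Proof.
have H1 x y z : pres_eq A R x y -> pres_eq A R (x ++ z) (y ++ z).
  elim=> {x y}; [move=> ?; exact: pres_refl | by move=> *; apply: pres_sym
    | by move=> ? y ? _ h _; exact: pres_trans | |].
    by move=> x s b y As; rewrite -!catA; exact: pres_cancel.
  by move=> x r y Rr; rewrite -!catA; exact: pres_relator.
have H2 x y z : pres_eq A R x y -> pres_eq A R (z ++ x) (z ++ y).
  elim=> {x y}; [move=> ?; exact: pres_refl | by move=> *; apply: pres_sym
    | by move=> ? y ? _ h _; exact: pres_trans | |].
    by move=> x s b y As; rewrite !(catA z); exact: pres_cancel.
  by move=> x r y Rr; rewrite !(catA z); exact: pres_relator.
by move=> h k; apply: (@pres_trans _ _ _ _ (u' ++ v)); [exact: H1|exact: H2].
Qed.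

Lemma pres_eq_cons A R c u v : pres_eq A R u v -> pres_eq A R (c :: u) (c :: v).
Proof. exact: (@pres_eq_cat A R [:: c] [:: c]) (pres_refl _ _ _). Qed.

Lemma pres_eq_linv A R c u : A c.1 -> pres_eq A R (c :: linv c :: u) u.
Proof. case: c => s b As; exact: (@pres_cancel _ A R [::]). Qed.

Lemma pres_eq_linvl A R c u : A c.1 -> pres_eq A R (linv c :: c :: u) u.
Proof. by move=> Ac; rewrite -{2}(linvK c); exact: pres_eq_linv. Qed.

(** The relator gives the swap of two positive letters; [swV] passes to an inverse letter by
    inserting a cancelling pair behind the other letter. *)
Lemma pres_eq_swap A c d u : A c.1 -> A d.1 -> c.1 <> d.1 ->
    commute c.1 d.1 ->
  pres_eq A (commutation_relators A) (c :: d :: u) (d :: c :: u).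
Proof.
set P := pres_eq _ _.
have swV e f : A e.1 -> A f.1 -> (forall v, P (e :: f :: v) (f :: e :: v)) ->
    forall v, P (linv e :: f :: v) (f :: linv e :: v).
  move=> Ae Af h v.
  apply: (@pres_trans _ _ _ _ (linv e :: f :: e :: linv e :: v)).
    by do 2!apply: pres_eq_cons; apply: pres_sym; exact: pres_eq_linv.
  apply: (@pres_trans _ _ _ _ (linv e :: e :: f :: linv e :: v)).
    by apply: pres_eq_cons; apply: pres_sym; exact: h.
  exact: pres_eq_linvl.
have base s t : A s -> A t -> s <> t -> commute s t ->
    forall v, P ((s, false) :: (t, false) :: v) ((t, false) :: (s, false) :: v).
  move=> As At st cst v.
  have h1 : P ((t, false) :: (s, false) :: [:: (s, true); (t, true); (s, false);
    (t, false)] ++ v)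
              ((t, false) :: (s, false) :: v).
    do 2!apply: pres_eq_cons.
    rewrite /P -[X in pres_eq _ _ _ X]/([::] ++ v) -[X in pres_eq _ _ X]cat0s.
    by apply: pres_relator; exists s, t.
  apply: pres_trans h1; apply: pres_sym => /=.
  apply: pres_trans (_ : P _ ((t,false) :: (t,true) :: (s,false) :: (t,false) :: v)) _.
    by apply: pres_eq_cons; exact: (@pres_eq_linv _ _ (s,false)).
  exact: (@pres_eq_linv _ _ (t,false)).
case: c d => [s b] [t b'] /= As At st cst.
have swb b1 v : P ((s, b1) :: (t, false) :: v) ((t, false) :: (s, b1) :: v).
  case: b1 v; last exact: base.
  by apply: (swV (s, false) (t, false)) => //; apply: base.
case: b'; last exact: swb.
apply: pres_sym; apply: (swV (t, false) (s, b)) => // v.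
by apply: pres_sym; exact: swb.
Qed.

Lemma pres_eq_pull A c u u' : word_over A u -> A c.1 -> pull c u = Some u' ->
  pres_eq A (commutation_relators A) u (c :: u').
Proof.
elim: u u' => //= d u IH u' Adu Ac; case: eqP => [-> [<-]|_]; first exact: pres_refl.
case: ifP => // cd; case E: pull => [u1|//] [<-].
have Ad : A d.1 by apply: Adu; rewrite mem_head.
apply: (@pres_trans _ _ _ _ (d :: c :: u1)).
  by apply: pres_eq_cons; apply: IH => // e eu; apply: Adu; rewrite in_cons eu orbT.
case/andP: cd => /eqP ncd /eqP ccd.
by apply: pres_eq_swap => //; apply: nesym.
Qed.

Lemma reduce_over A u : word_over A u -> word_over A (reduce [::] u).
Proof. by move=> Au c /reduce_mem /Au. Qed.

(** Reduction introduces no new letters, so it can be carried out within the presentation over [A];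
    [sub_raag] rests on this. *)
Lemma pres_eq_reduce_self A u : word_over A u ->
  pres_eq A (commutation_relators A) u (reduce [::] u).
Proof.
elim: u => [_|c u IH Acu] /=; first exact: pres_refl.
have Ac : A c.1 by apply: Acu; rewrite mem_head.
have Au : word_over A u by move=> e eu; apply: Acu; rewrite in_cons eu orbT.
apply: pres_trans (pres_eq_cons _ (IH Au)) _.
rewrite /act; case E: pull => [v|]; last exact: pres_refl.
apply: (@pres_trans _ _ _ _ (c :: linv c :: v)); last exact: pres_eq_linv.
by apply: pres_eq_cons; apply: pres_eq_pull E => //; exact: reduce_over.
Qed.

Definition winv u := rev (map linv u).

Lemma winv_cons c u : winv (c :: u) = winv u ++ [:: linv c].
Proof. by rewrite /winv /= rev_cons cats1. Qed.

Lemma eval_winv u : eval_word (winv u) = (eval_word u)^-1.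
Proof.
elim: u => [|c u IH]; first by rewrite /winv /= eval_nil invg1.
by rewrite winv_cons eval_cat eval_cons eval_nil mulg1 IH eval_cons lvalV invgM.
Qed.

Lemma mem_winv c u : (c \in winv u) = (linv c \in u).
Proof. by rewrite /winv mem_rev -{1}(linvK c) mem_map //; apply: can_inj linvK. Qed.

Lemma reduce_winv x u : red x -> teq (reduce x (winv u ++ u)) x.
Proof.
move=> rx; elim: u x rx => [|c u IH] x rx; first exact: teq_refl.
rewrite winv_cons -catA /= reduce_cat /=.
apply: teq_trans (IH x rx); rewrite [in X in teq _ X]reduce_cat.
apply: reduce_teq.
have := @actK (linv c) (reduce x u); rewrite linvK; apply.
exact: reduce_red.
Qed.

(** The letters of [u] are handed over to [v] one by one, inverted. A letter that then heads both
    words is not the new head, because [u] is reduced; so it is independent of the new head and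
    headed both words before. *)
Lemma red_winv_cat u v : red u -> red v ->
  (forall c, pull c u -> ~~ pull c v) -> red (winv u ++ v).
Proof.
elim: u v => //= d u IH v /andP[du ru] rv nc.
rewrite winv_cons -catA; apply: IH => //=.
  by rewrite linvK rv andbT; apply: nc => /=; rewrite eqxx.
move=> c cu; case: eqP => [dc|_]; first by move: du; rewrite dc cu.
rewrite indepVr; case: ifP => // cd.
apply/negP => cv; have : pull c (d :: u).
  by rewrite /= cd; case: eqP => // _; case: pull cu.
by move=> /nc; case: pull cv.
Qed.

End Words.

(** * Prefix order, meets and orthogonality *)

(* Products elaborated at different structures are convertible but not
   syntactically equal, so the lengths are abstracted up to conversion. *)
Ltac len_lia :=
  repeat match goal with H : context [len _ _] |- _ => revert H end;
  repeat match goal with |- context [len ?S ?t] =>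
    let n := fresh "n" in set n := (len S t); clearbody n end;
  lia.

Section Raag.
Variables (G : groupType) (S : set G).
Hypothesis hG : is_raag [set: G] S.
Implicit Types (c d : (G * bool)%type) (u v : word G) (w x y z m r : G) (A : set G).

(* Unlike mulgA, this keeps all products at the group structure, so that rewriting
   with equations between products still applies afterwards. *)
Lemma gmulA x y z : x * (y * z) = x * y * z.
Proof. exact: mulgA. Qed.

Lemma word_over_cat A u v : word_over A u -> word_over A v -> word_over A (u ++ v).
Proof. by move=> h k c; rewrite mem_cat => /orP[/h|/k]. Qed.

Lemma word_over_winv A u : word_over A u -> word_over A (winv u).
Proof. by move=> h c; rewrite mem_winv => /h. Qed.

Lemma word_over_cons A c u : A c.1 -> word_over A u -> word_over A (c :: u).
Proof. by move=> h k d; rewrite in_cons => /orP[/eqP->|/k]. Qed.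

Lemma generated_word A x : generated A x ->
  exists u, word_over A u /\ eval_word u = x.
Proof.
move=> gx; pose X := [set x | exists u, word_over A u /\ eval_word u = x].
suff : generated A `<=` X by apply.
apply: smallest_sub; last first.
  move=> s As; exists [:: (s, false)]; split; last by rewrite eval_cons eval_nil mulg1.
  by move=> c; rewrite inE => /eqP ->.
split.
- by exists [::]; rewrite eval_nil.
- move=> _ _ [u [Au <-]] [v [Av <-]]; exists (u ++ v).
  by rewrite eval_cat; split => //; apply: word_over_cat.
- move=> _ [u [Au <-]]; exists (winv u); rewrite eval_winv; split=> //.
  exact: word_over_winv.
Qed.

(** * Normal forms and lengths in the group *)

Lemma ex_reduced x : exists u, [/\ word_over S u, red u & eval_word u = x].
Proof.
have [_ [hgen _]] := hG.
have [u [Su <-]] : exists u, word_over S u /\ eval_word u = x.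
  by apply: generated_word; rewrite -hgen.
exists (reduce [::] u); split; [exact: reduce_over|exact: reduce_red|].
by rewrite reduce_eval eval_nil mulg1.
Qed.

Definition rw x : word G := sval (cid (ex_reduced x)).

Lemma rw_over x : word_over S (rw x).
Proof. by rewrite /rw; case: cid => u /= []. Qed.

Lemma rw_red x : red (rw x).
Proof. by rewrite /rw; case: cid => u /= []. Qed.

Lemma rw_eval x : eval_word (rw x) = x.
Proof. by rewrite /rw; case: cid => u /= []. Qed.

(** The word [u ++ winv v] represents 1, so it acts trivially on [v]; but [winv v] takes [v] to the
    empty word, from which [u] rebuilds itself. *)
Lemma reduced_unique u v : word_over S u -> word_over S v -> red u -> red v ->
  eval_word u = eval_word v -> teq u v.
Proof.
move=> Su Sv ru rv euv; have [_ [_ hpres]] := hG.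
have Suv : word_over S (u ++ winv v) by apply: word_over_cat => //; exact: word_over_winv.
have /(hpres _ Suv) : eval_word (u ++ winv v) = 1.
  by rewrite eval_cat eval_winv euv mulgV.
move=> /pres_eq_reduce /(_ v rv) h.
apply: teq_trans h; rewrite reduce_cat -{1}(reduce_id ru).
apply: reduce_teq; apply: teq_sym.
by have := @reduce_winv _ [::] v isT; rewrite reduce_cat (reduce_id rv).
Qed.

Lemma rwP u x : word_over S u -> red u -> eval_word u = x -> teq (rw x) u.
Proof.
move=> Su ru eu; apply: reduced_unique => //; [exact: rw_over|exact: rw_red|].
by rewrite rw_eval.
Qed.

Lemma size_rw_le u : word_over S u -> (size (rw (eval_word u)) <= size u)%N.
Proof.
move=> Su; have h : teq (rw (eval_word u)) (reduce [::] u).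
  apply: rwP; [exact: reduce_over|exact: reduce_red|].
  by rewrite reduce_eval eval_nil mulg1.
by rewrite (teq_size h) reduce_size.
Qed.

Lemma len_rw x : len S x = size (rw x).
Proof.
have wl : is_word_length S x (size (rw x)).
  split; first by exists (rw x); split; [exact: rw_over|exact: rw_eval|].
  by move=> u Su <-; exact: size_rw_le.
rewrite /len; have := xgetPex 0%N (ex_intro _ _ wl).
set n := xget _ _ => -[[u [Su eu su]] min].
apply/eqP; rewrite eqn_leq; apply/andP; split.
  by apply: min; [exact: rw_over|exact: rw_eval].
by rewrite -su -eu size_rw_le.
Qed.

(** The product has no cancellation. [geodE] makes this an equation between lengths, through which
    inversion and reassociation are handled. *)
Definition geod x y := red (rw x ++ rw y).

Lemma rw_geod x y : geod x y -> teq (rw (x * y)) (rw x ++ rw y).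
Proof.
move=> a; apply: rwP => //; last by rewrite eval_cat !rw_eval.
by apply: word_over_cat; exact: rw_over.
Qed.

Lemma lenM x y : (len S (x * y) <= len S x + len S y)%N.
Proof.
rewrite !len_rw -size_cat -{1}(rw_eval x) -{1}(rw_eval y) -eval_cat.
by apply: size_rw_le; apply: word_over_cat; exact: rw_over.
Qed.

Lemma geodE x y : geod x y <-> len S (x * y) = (len S x + len S y)%N.
Proof.
split=> [/rw_geod/teq_size|]; first by rewrite !len_rw size_cat.
rewrite !len_rw -size_cat => h; apply: size_reduce_red; rewrite -h.
apply: teq_size; apply: reduced_unique; rewrite ?rw_red ?reduce_red //.
- by apply: reduce_over; apply: word_over_cat; exact: rw_over.
- exact: rw_over.
- by rewrite reduce_eval eval_nil mulg1 eval_cat !rw_eval.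
Qed.

Lemma rw1 : rw 1 = [::].
Proof.
have t : teq (rw 1) [::] by apply: rwP => //; rewrite eval_nil.
by apply/nilP; rewrite /nilp (teq_size t).
Qed.

Lemma len1 : len S 1 = 0%N. Proof. by rewrite len_rw rw1. Qed.

Lemma len_eq0 x : len S x = 0%N -> x = 1.
Proof. by rewrite len_rw => /size0nil h; rewrite -(rw_eval x) h eval_nil. Qed.

Lemma rwV x : teq (rw x^-1) (winv (rw x)).
Proof.
apply: rwP; last by rewrite eval_winv rw_eval.
  by apply: word_over_winv; exact: rw_over.
by rewrite -[winv _]cats0; apply: red_winv_cat => //; exact: rw_red.
Qed.

Lemma lenV x : len S x^-1 = len S x.
Proof. by rewrite !len_rw (teq_size (rwV x)) /winv size_rev size_map. Qed.

Lemma geodV x y : geod x y -> geod y^-1 x^-1.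
Proof. by move/geodE => h; apply/geodE; rewrite -invgM !lenV h addnC. Qed.

Lemma geod_assoc x y z : geod x y -> geod (x * y) z -> geod y z /\ geod x (y * z).
Proof.
move=> /geodE h /geodE; rewrite -gmulA h => k.
have l1 := lenM y z; have l2 := lenM x (y * z).
by split; apply/geodE; len_lia.
Qed.

Lemma geod_assocV x y z : geod y z -> geod x (y * z) -> geod x y /\ geod (x * y) z.
Proof.
move=> /geodE h /geodE; rewrite gmulA h => k.
have l1 := lenM x y; have l2 := lenM (x * y) z.
by split; apply/geodE; len_lia.
Qed.

Lemma geod1 x : geod x 1. Proof. by apply/geodE; rewrite mulg1 len1 addn0. Qed.
Lemma geod1l x : geod 1 x. Proof. by apply/geodE; rewrite mul1g len1 add0n. Qed.

(** * The prefix order and first letters *)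

Local Notation pre := (prec S).

Lemma preE x y : pre x y <-> geod x (x^-1 * y).
Proof. by split=> [h|/geodE]; [apply/geodE|]; rewrite /prec mulVKg. Qed.

Lemma pre_geod x y : geod x y -> pre x (x * y).
Proof. by move=> h; apply/preE; rewrite mulKg. Qed.

Lemma preP x y : pre x y -> exists2 z, y = x * z & geod x z.
Proof. by move/preE => h; exists (x^-1 * y) => //; rewrite mulVKg. Qed.

Lemma pre_refl x : pre x x.
Proof. by rewrite /prec mulVg len1 addn0. Qed.

Lemma pre1 x : pre 1 x.
Proof. by rewrite /prec invg1 mul1g len1. Qed.

Lemma pre_trans y x z : pre x y -> pre y z -> pre x z.
Proof.
move=> /preP[u -> a] /preP[v -> b]; have [_] := geod_assoc a b.
by rewrite -gmulA; exact: pre_geod.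
Qed.

Lemma pre_len x y : pre x y -> (len S x <= len S y)%N.
Proof. by rewrite /prec => <-; exact: leq_addr. Qed.

Lemma pre_eq x y : pre x y -> (len S y <= len S x)%N -> x = y.
Proof.
move=> /preP[z -> /geodE ->] h; rewrite (@len_eq0 z) ?mulg1 //; len_lia.
Qed.

Lemma pre_anti x y : pre x y -> pre y x -> x = y.
Proof. by move=> h /pre_len; exact: pre_eq. Qed.

Lemma pre_mull z x y : geod z y -> pre x y -> pre (z * x) (z * y).
Proof.
move=> a /preP[r yE b]; rewrite yE in a *; have [_ h] := geod_assocV b a.
by rewrite gmulA; exact: pre_geod.
Qed.

Lemma geod_prel z x y : geod z y -> pre x y -> geod z x.
Proof. by move=> a /preP[r yE b]; rewrite yE in a; have [] := geod_assocV b a. Qed.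

Lemma pre_mullI z x y : geod z x -> geod z y -> pre (z * x) (z * y) -> pre x y.
Proof.
move=> /geodE a /geodE b; rewrite /prec a b.
have -> : (z * x)^-1 * (z * y) = x^-1 * y by rewrite invgM -gmulA mulKg.
len_lia.
Qed.

Definition starts c x : bool := pull c (rw x).

Lemma starts_mem c x : starts c x -> c \in rw x. Proof. exact: pull_mem. Qed.
Lemma starts_over c x : starts c x -> S c.1. Proof. by move/starts_mem/rw_over. Qed.

Lemma rw_lval c : S c.1 -> teq (rw (lval c)) [:: c].
Proof.
move=> Sc; apply: rwP => //; last by rewrite eval_cons eval_nil mulg1.
exact: word_over_cons.
Qed.

Lemma rw_starts c x : starts c x -> teq (rw x) (c :: rw ((lval c)^-1 * x)).
Proof.
rewrite /starts; case E: pull => [u|//] _.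
apply: teq_trans (pull_teq E) _; apply: teq_cons; apply: teq_sym.
have Scu : word_over S (c :: u).
  by move=> d; rewrite -(teq_mem (pull_teq E)) => /rw_over.
apply: rwP; last by rewrite -(rw_eval x) (pull_eval E) mulKg.
  by move=> d du; apply: Scu; rewrite in_cons du orbT.
by case: (red_pull (rw_red x) E).
Qed.

Lemma len_starts c x : starts c x -> len S x = (len S ((lval c)^-1 * x)).+1.
Proof. by rewrite !len_rw => /rw_starts/teq_size. Qed.

Lemma len_lval c : S c.1 -> len S (lval c) = 1%N.
Proof. by rewrite len_rw => /rw_lval/teq_size. Qed.

Lemma starts_geod c x : starts c x -> geod (lval c) ((lval c)^-1 * x).
Proof.
by move=> h; apply/geodE; rewrite mulVKg (len_starts h) len_lval //; exact: starts_over h.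
Qed.

Lemma startsP c x : S c.1 -> starts c x <-> pre (lval c) x.
Proof.
move=> Sc; split=> [/starts_geod/preE //|/preE a].
have := rw_geod a; rewrite mulVKg => t.
have := teq_trans t (teq_cat (rw_lval Sc) (teq_refl _)) => /= t'.
by rewrite /starts (teq_pull c t') /= eqxx.
Qed.

Lemma starts_pre c x y : pre x y -> starts c x -> starts c y.
Proof. by move=> xy h; have Sc := starts_over h; apply/startsP => //;
  apply: pre_trans xy; exact/startsP. Qed.

Lemma ex_starts x : x <> 1 -> exists c, starts c x.
Proof.
move=> x1; rewrite /starts; case E: (rw x) => [|c u].
  by case: x1; apply: len_eq0; rewrite len_rw E.
by exists c; rewrite /= eqxx.
Qed.

Definition indep_all c x := all (indep c) (rw x).

Lemma starts_split c x z : geod x z -> starts c (x * z) ->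
  starts c x \/ (indep_all c x /\ starts c z).
Proof.
move=> /rw_geod t; rewrite /starts (teq_pull c t) pull_cat.
case: pull => [u|]; first by left.
by rewrite /indep_all; case: all => // h; right; split => //; case: pull h.
Qed.

Lemma starts_indep c x y : indep_all c x -> starts c y -> geod x y -> starts c (x * y).
Proof.
move=> h k /rw_geod t; rewrite /starts (teq_pull c t) pull_cat.
case: (pull c (rw x)) => //; rewrite -/(indep_all c x) h.
by move: k; rewrite /starts; case: pull.
Qed.

Lemma indep_all_commute c x : indep_all c x -> commute (lval c) x.
Proof.
rewrite /indep_all -{2}(rw_eval x); elim: (rw x) => [_|d u IH /= /andP[cd cu]].
  by rewrite eval_nil; exact: commute1.
by rewrite eval_cons; apply: commuteM; [exact: indep_commute|exact: IH].
Qed.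

(** * Greatest common prefixes *)

Definition lcoprime x y := forall c, starts c x -> ~~ starts c y.

Lemma lcoprimeC x y : lcoprime x y -> lcoprime y x.
Proof. by move=> h c cy; apply/negP => /h; rewrite cy. Qed.

Lemma lcoprime_geod x y : lcoprime x y -> geod x^-1 y.
Proof.
move=> h; apply: (@teq_red _ (winv (rw x) ++ rw y)).
  by apply: teq_cat => //; apply: teq_sym; exact: rwV.
by apply: red_winv_cat => //; exact: rw_red.
Qed.

Lemma geod_lcoprime x y : geod x^-1 y -> lcoprime x y.
Proof.
move=> /geodE a c cx; apply/negP => cy.
have := len_starts cx; have := len_starts cy; move: a; rewrite lenV.
have -> : x^-1 * y = ((lval c)^-1 * x)^-1 * ((lval c)^-1 * y).
  by rewrite invgM invgK -gmulA mulVKg.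
by have := lenM ((lval c)^-1 * x)^-1 ((lval c)^-1 * y); rewrite lenV; len_lia.
Qed.

Lemma lcoprime_geodP x y : lcoprime x^-1 y <-> geod x y.
Proof.
by split=> h; [rewrite -(invgK x); exact: lcoprime_geod|apply: geod_lcoprime;
  rewrite invgK].
Qed.

Lemma lcoprime_pre x y z : lcoprime x y -> pre z y -> lcoprime x z.
Proof. by move=> h zy c /h; apply: contra; exact: starts_pre. Qed.

(** A first letter of [z] that does not start [m] would have to pass [m] and start both [x] and [y].
    So it starts [m], and can be divided out of [z] and [m]. *)
Lemma lcoprime_glb m x y z : geod m x -> geod m y -> lcoprime x y ->
  pre z (m * x) -> pre z (m * y) -> pre z m.
Proof.
have [n] := ubnP (len S z); elim: n z m => // n IH z m zn mx my nxy zx zy.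
have [->|/eqP z1] := eqVneq z 1; first exact: pre1.
have [c cz] := ex_starts z1; have lz := len_starts cz; have az := starts_geod cz.
have cx := starts_pre zx cz; have cy := starts_pre zy cz.
have [cm|ncm] := boolP (starts c m); last first.
  case: (starts_split mx cx) (starts_split my cy) ncm => [->//|[_ cx']] [->//|[_ cy'] _].
  by have := nxy _ cx'; rewrite cy'.
have am := starts_geod cm.
set z' := (lval c)^-1 * z in lz az; set m' := (lval c)^-1 * m in am.
have zE : z = lval c * z' by rewrite mulVKg.
have mE : m = lval c * m' by rewrite mulVKg.
clearbody z' m'; rewrite mE in mx my zx zy *; rewrite zE in zx zy *.
have [m'x cm'x] := geod_assoc am mx; have [m'y cm'y] := geod_assoc am my.
rewrite -!gmulA in zx zy.
apply: pre_mull => //; apply: IH => //; first len_lia.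
  exact: pre_mullI az cm'x zx.
exact: pre_mullI az cm'y zy.
Qed.

(** Common first letters are divided out until none is left. *)
Lemma ex_gcd x y : exists m x' y',
  [/\ x = m * x', y = m * y', geod m x', geod m y' & lcoprime x' y'].
Proof.
have [n] := ubnP (len S x); elim: n x y => // n IH x y xn.
have [[c cx cy]|no] := pselect (exists2 c, starts c x & starts c y); last first.
  exists 1, x, y; rewrite !mul1g; split=> //; try exact: geod1l.
  by move=> c cx; apply/negP => cy; apply: no; exists c.
have lx := len_starts cx; have ax := starts_geod cx; have ay := starts_geod cy.
have [|m [x' [y' [xE yE mx my nxy]]]] := IH ((lval c)^-1 * x) ((lval c)^-1 * y).
  len_lia.
exists (lval c * m), x', y'; rewrite xE in ax; rewrite yE in ay.
rewrite -!gmulA -xE -yE !mulVKg; split=> //.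
  by have [] := geod_assocV mx ax.
by have [] := geod_assocV my ay.
Qed.

Lemma is_meet_gcd m x y : geod m x -> geod m y -> lcoprime x y ->
  is_meet S (m * x) (m * y) m.
Proof.
by move=> mx my n; split; try exact: pre_geod; move=> z; exact: lcoprime_glb.
Qed.

Lemma is_meet_unique x y m m' : is_meet S x y m -> is_meet S x y m' -> m = m'.
Proof.
move=> [mx my hm] [mx' my' hm']; apply: pre_anti; [exact: hm'|exact: hm].
Qed.

Lemma meet_unique x y m : is_meet S x y m -> meet S x y = m.
Proof.
move=> h; apply: (@is_meet_unique x y) => //.
by have := xgetPex 1 (ex_intro _ _ h).
Qed.

Lemma meet_gcd m x y : geod m x -> geod m y -> lcoprime x y ->
  meet S (m * x) (m * y) = m.
Proof. by move=> *; apply: meet_unique; exact: is_meet_gcd. Qed.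

(** Since greatest common prefixes exist, the default value in [meet] is never the result of a
    failed choice, and a meet can be handled through its two cofactors. *)
Lemma meetP x y : let m := meet S x y in exists x' y',
  [/\ x = m * x', y = m * y', geod m x', geod m y' & lcoprime x' y'].
Proof.
have [m [x' [y' [-> -> mx my n]]]] := ex_gcd x y.
by rewrite meet_gcd //; exists x', y'.
Qed.

Lemma lcoprime1 x : lcoprime 1 x. Proof. by move=> c; rewrite /starts rw1. Qed.

Lemma meet1P x y : meet S x y = 1 <-> lcoprime x y.
Proof.
split=> [m1|n]; last by rewrite -(mul1g x) -(mul1g y) meet_gcd //; exact: geod1l.
by have := meetP x y; rewrite m1 => -[x' [y' [-> ->]]]; rewrite !mul1g.
Qed.

Lemma meet_pre x y : pre x y -> meet S x y = x.
Proof.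
move=> /preP[z -> a]; rewrite -{1}(mulg1 x).
by apply: meet_gcd => //; [exact: geod1|exact: lcoprime1].
Qed.

Lemma meetC x y : meet S x y = meet S y x.
Proof.
have [x' [y' [xE yE mx my n]]] := meetP x y.
by rewrite {2}yE {3}xE meet_gcd //; exact: lcoprimeC.
Qed.

(** * Orthogonality and supports *)

Definition ortho x y := forall c d, c \in rw x -> d \in rw y -> indep c d.

Lemma orthoC x y : ortho x y -> ortho y x.
Proof. by move=> h c d cy dx; rewrite indepC; exact: h. Qed.

Lemma indep_all_ortho x y : (forall c, c \in rw x -> indep_all c y) <-> ortho x y.
Proof.
split=> [h c d /h /allP|h c cx]; first exact.
by apply/allP => d dy; exact: h.
Qed.

Lemma ortho_commute x y : ortho x y -> commute x y.
Proof.
move=> h; rewrite -(rw_eval x).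
have : {in rw x, forall c, indep_all c y} by exact/indep_all_ortho.
elim: (rw x) => [_|c u IH k]; first by rewrite eval_nil; apply/commute_sym/commute1.
rewrite eval_cons; apply/commute_sym/commuteM; apply/commute_sym.
  by apply: indep_all_commute; apply: k; rewrite mem_head.
by apply: IH => d du; apply: k; rewrite in_cons du orbT.
Qed.

Definition within A x := forall c, c \in rw x -> A c.1.

Lemma mem_rwV c x : (c \in rw x^-1) = (linv c \in rw x).
Proof. by rewrite (teq_mem (rwV x)) mem_winv. Qed.

Lemma mem_rwM x y : {subset rw (x * y) <= rw x ++ rw y}.
Proof.
have Sxy : word_over S (rw x ++ rw y) by apply: word_over_cat; exact: rw_over.
have t : teq (rw (x * y)) (reduce [::] (rw x ++ rw y)).
  apply: rwP; [exact: reduce_over|exact: reduce_red|].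
  by rewrite reduce_eval eval_cat !rw_eval eval_nil mulg1.
by move=> c; rewrite (teq_mem t) => /reduce_mem.
Qed.

Lemma mem_rw_geod c x y : geod x y -> (c \in rw (x * y)) = (c \in rw x) || (c \in rw y).
Proof. by move/rw_geod/teq_mem ->; rewrite mem_cat. Qed.

Lemma mem_rw_pre x y : pre x y -> {subset rw x <= rw y}.
Proof. by move=> /preP[z -> a] c cx; rewrite mem_rw_geod // cx. Qed.

Lemma within1 A : within A 1. Proof. by move=> c; rewrite rw1. Qed.
Lemma withinM A x y : within A x -> within A y -> within A (x * y).
Proof. by move=> hx hy c /mem_rwM; rewrite mem_cat => /orP[/hx|/hy]. Qed.
Lemma withinV A x : within A x -> within A x^-1.
Proof. by move=> h c; rewrite mem_rwV => /h. Qed.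
Lemma withinX A x n : within A x -> within A (x ^+ n).
Proof. by move=> h; elim: n => [|n IH]; [exact: within1|rewrite expgS;
  exact: withinM]. Qed.
Lemma within_pre A x y : pre x y -> within A y -> within A x.
Proof. by move=> h k c /(mem_rw_pre h) /k. Qed.
(** With [x] fixed, orthogonality becomes a condition on the generators occurring in the other
    element, so it inherits the closure properties of [within]. *)
Definition link x : set G := [set s | forall c, c \in rw x -> indep c (s, false)].

Lemma ortho_link x y : ortho x y <-> within (link x) y.
Proof. by split=> [h d dy c cx|h c d cx dy]; [exact: (h c d)|exact: (h d dy c cx)]. Qed.

Lemma ortho1 x : ortho x 1. Proof. by apply/ortho_link; exact: within1. Qed.
Lemma orthoM x y z : ortho x y -> ortho x z -> ortho x (y * z).
Proof. by move=> /ortho_link h /ortho_link k; apply/ortho_link; exact: withinM. Qed.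
Lemma orthoV x y : ortho x y -> ortho x y^-1.
Proof. by move=> /ortho_link h; apply/ortho_link; exact: withinV. Qed.
Lemma orthoX x y n : ortho x y -> ortho x (y ^+ n).
Proof. by move=> /ortho_link h; apply/ortho_link; exact: withinX. Qed.
Lemma ortho_pre x y z : pre z y -> ortho x y -> ortho x z.
Proof. by move=> zy /ortho_link h; apply/ortho_link; exact: within_pre zy h. Qed.

Lemma ortho_lcoprime x y : ortho x y -> lcoprime x y.
Proof.
move=> h c /starts_mem cx; apply/negP => /starts_mem cy.
by have := h _ _ cx cy; rewrite indep_irr.
Qed.

Lemma ortho_geod x y : ortho x y -> geod x y.
Proof. by move=> h; apply/lcoprime_geodP/ortho_lcoprime/orthoC/orthoV/orthoC. Qed.

Lemma ortho_refl x : ortho x x -> x = 1.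
Proof. by move=> /ortho_lcoprime h; apply: contrapT => /ex_starts[c cx];
  have := h c cx; rewrite cx. Qed.

(** A first letter [c] of [y] starts the bound [z = x * r] but not [x], so it passes all of [x] and
    starts [r]. Dividing [y] and [z] by [c] keeps [x] below [z], and the induction applies. *)
Lemma pre_lcoprime_ortho x y z : pre x z -> pre y z -> lcoprime x y ->
  ortho x y /\ pre (x * y) z.
Proof.
have [n] := ubnP (len S y); elim: n y z => // n IH y z yn xz yz nxy.
have [->|/eqP y1] := eqVneq y 1; first by split; [exact: ortho1|rewrite mulg1].
have [c cy] := ex_starts y1; have ly := len_starts cy; have ay := starts_geod cy.
have cz := starts_pre yz cy; have lz := len_starts cz; have az := starts_geod cz.
move: xz => /preP[r zE axr]; move: (cz); rewrite zE => /(starts_split axr).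
case=> [cx|[cx cr]]; first by have := nxy _ cx; rewrite cy.
have lr := len_starts cr; have comm := indep_all_commute cx.
set y' := (lval c)^-1 * y in ly ay; set r' := (lval c)^-1 * r in lr.
set z' := (lval c)^-1 * z in lz az.
have yE : y = lval c * y' by rewrite mulVKg.
have rE : r = lval c * r' by rewrite mulVKg.
have z'E : z' = x * r'.
  by rewrite /z' zE rE gmulA -comm -gmulA mulKg.
have xz' : pre x z'.
  rewrite z'E; apply: pre_geod; apply/geodE; move/geodE: axr.
  rewrite -z'E -zE; len_lia.
have [] := IH y' z' _ xz'; first len_lia.
- apply: (@pre_mullI (lval c)) => //; by rewrite -yE mulVKg.
(* A common first letter [d] of [x] and [y'] is independent of [c], being a letter of [x]; so it
   would pass [c] and start [y]. *)
- move=> d dx; apply/negP => dy'.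
  have : starts d y.
    have cd : indep d c by rewrite indepC; apply: (allP cx); exact: starts_mem.
    rewrite yE; apply: starts_indep => //; apply/allP => e.
    by rewrite (teq_mem (rw_lval (starts_over cy))) inE => /eqP ->.
  by move=> dy; have := nxy _ dx; rewrite dy.
move=> oxy' xyz'; split.
  rewrite yE; apply: orthoM => //; apply: orthoC; apply/indep_all_ortho => d.
  by rewrite (teq_mem (rw_lval (starts_over cy))) inE => /eqP ->.
rewrite -zE yE gmulA -comm -gmulA; have -> : z = lval c * z' by rewrite mulVKg.
exact: pre_mull.
Qed.

Lemma pre_ortho x y z : pre x z -> pre y z -> lcoprime x y -> ortho x y.
Proof. by move=> xz yz n; have [] := pre_lcoprime_ortho xz yz n. Qed.

Lemma orthP x y : orth S x y <-> ortho x y.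
Proof.
split=> [[/meet1P n [j [xj yj _]]]|o]; first exact: pre_ortho xj yj n.
split; first exact/meet1P/ortho_lcoprime.
exists (x * y); split; first exact/pre_geod/ortho_geod.
  by rewrite (ortho_commute o); apply/pre_geod/ortho_geod/orthoC.
by move=> z xz yz; have [] := pre_lcoprime_ortho xz yz (ortho_lcoprime o).
Qed.

End Raag.

(** * Cyclically reduced elements *)

Section Cyclic.
Variables (G : groupType) (S : set G).
Hypothesis hG : is_raag [set: G] S.
Implicit Types (c d : (G * bool)%type) (u v w x y z m r g p q t : G) (A : set G).

Local Notation pre := (prec S).
Local Notation rw := (rw hG).
Local Notation geod := (geod hG).
Local Notation starts := (starts hG).
Local Notation indep_all := (indep_all hG).
Local Notation ortho := (ortho hG).
Local Notation within := (within hG).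
Local Notation lcoprime := (lcoprime hG).

Definition cycred w := lcoprime w w^-1.

Lemma cycredP w : cyclically_reduced S w <-> cycred w.
Proof. exact: meet1P. Qed.

Lemma cycred_geodP w : cycred w <-> geod w w.
Proof.
by split=> [h|/lcoprime_geodP h]; [apply/lcoprime_geodP|]; exact: lcoprimeC.
Qed.

Lemma cycredV w : cycred w -> cycred w^-1.
Proof. by rewrite /cycred invgK; exact: lcoprimeC. Qed.

Lemma indep_allV c x : indep_all c x^-1 = indep_all c x.
Proof.
apply/allP/allP => h d dx; rewrite -indepVr; apply: h.
  by rewrite mem_rwV linvK.
by rewrite -mem_rwV.
Qed.

Lemma indep_all_mem c x : indep_all c x -> c \notin rw x.
Proof. by move=> /allP h; apply/negP => /h; rewrite indep_irr. Qed.

Lemma indep_all_nstarts c x : indep_all c x -> starts c x = false.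
Proof. by move=> /indep_all_mem h; apply/negP => /starts_mem; apply/negP. Qed.

(** A letter cancelling between [w] and its power starts [w^-1]; as a first letter of the power, it
    also starts [w] or is independent of [w], and neither is possible. *)
Lemma cycred_geodX w n : cycred w -> geod w (w ^+ n).
Proof.
move=> cr; elim: n => [|n IH]; first exact: geod1.
apply/lcoprime_geodP => c cV; apply/negP; rewrite expgS => /(starts_split IH) [cw|[cw _]].
  by have := cr c cw; rewrite cV.
by move: cw; rewrite -indep_allV => /indep_all_nstarts; rewrite cV.
Qed.

Lemma cycred_len w n : cycred w -> len S (w ^+ n) = (n * len S w)%N.
Proof.
move=> cr; elim: n => [|n IH]; first by rewrite expg0 (len1 hG).
by have /geodE := cycred_geodX n cr; rewrite -expgS => ->; rewrite IH mulSn.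
Qed.

Lemma cycred_geodXX w n k : cycred w -> geod (w ^+ n) (w ^+ k).
Proof. by move=> cr; apply/geodE; rewrite -expgnDr !cycred_len // mulnDl. Qed.

Lemma cycredX w n : cycred w -> cycred (w ^+ n).
Proof. by move=> cr; apply/cycred_geodP; exact: cycred_geodXX. Qed.

Lemma cycred_preX w n k : cycred w -> (n <= k)%N -> pre (w ^+ n) (w ^+ k).
Proof. by move=> cr /subnKC <-; rewrite expgnDr; apply: pre_geod;
  exact: cycred_geodXX. Qed.

Definition supp w : set G := [set s | exists b, (s, b) \in rw w].

Lemma suppE w c : supp w c.1 <-> (c \in rw w) || (linv c \in rw w).
Proof.
case: c => s b; split=> [[b']|/orP[]]; rewrite /linv /=; last 2 first.
- by move=> h; exists b.
- by move=> h; exists (~~ b).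
by case: b b' => [] [] /= ->; rewrite ?orbT.
Qed.

Lemma within_supp w : within (supp w) w.
Proof. by case=> s b h; exists b. Qed.

Lemma within_trans w x y : within (supp w) x -> within (supp x) y -> within (supp w) y.
Proof. by move=> h k [s b] /k [b'] /h. Qed.

Lemma ortho_supp w x t : within (supp w) x -> ortho t w -> ortho t x.
Proof.
move=> h k d c dt cx; have /suppE := h c cx.
by case/orP => /(k _ _ dt) //; rewrite indepVr.
Qed.

Lemma within_suppV w : within (supp w^-1) w.
Proof. by move=> c cw; apply/suppE; rewrite !mem_rwV linvK cw orbT. Qed.

Lemma within_suppX w n : cycred w -> (0 < n)%N -> within (supp (w ^+ n)) w.
Proof.
move=> cr n0; apply: (within_pre (y := w ^+ n)); last exact: within_supp.
by rewrite -{1}(expg1 w); exact: cycred_preX.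
Qed.

(** * Conjugation onto a cyclically reduced core *)

Lemma conj_reduce p : exists g u,
  [/\ p = g * u * g^-1, len S p = (len S g + len S u + len S g)%N & cycred u].
Proof.
have [n] := ubnP (len S p); elim: n p => // n IH p pn.
have [cr|ncr] := pselect (cycred p).
  by exists 1, p; split=> //; rewrite ?invg1 ?mulg1 ?mul1g // (len1 hG) addn0.
have [c cp cV] : exists2 c, starts c p & starts c p^-1.
  apply: contrapT => no; apply: ncr => c cp; apply/negP => cV.
  by apply: no; exists c.
have lp := len_starts cp; have ap := starts_geod cp; have Sc := starts_over cp.
set p' := (lval c)^-1 * p in lp ap.
have pE : p = lval c * p' by rewrite mulVKg.
have aV := geodV ap.
(* Otherwise [c] would have to pass [p'^-1] and start the inverse letter of [c]. *)
have cp' : starts c p'^-1.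
  move: cV; rewrite pE invgM => /(starts_split aV) [//|[_]].
  rewrite -lvalV => /starts_mem; rewrite (teq_mem (rw_lval hG _)) // inE.
  by rewrite eq_sym linv_neq.
have lq := len_starts cp'; set q := (lval c)^-1 * p'^-1 in lq.
have p'E : p' = q^-1 * (lval c)^-1 by rewrite -invgM mulVKg invgK.
have [|g [u [qE lu cru]]] := IH q^-1.
  rewrite (lenV hG); move: lq; rewrite (lenV hG) => lq; len_lia.
exists (lval c * g), u; split => //; first by rewrite pE p'E qE invgM !mulgA.
(* Exactly two letters were peeled off [p], so these triangle inequalities must be equalities. *)
have lcg := lenM hG (lval c) g.
have l1 := lenM hG (lval c * g) u; have l2 := lenM hG (lval c * g * u) (lval c * g)^-1.
have lpE : len S (lval c * g * u * (lval c * g)^-1) = len S p.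
  by rewrite pE p'E qE invgM !mulgA.
rewrite (len_lval hG Sc) in lcg; rewrite (lenV hG) in l2.
rewrite (lenV hG) in lq; rewrite (lenV hG) in lu.
len_lia.
Qed.

(** For [v = g * u * g^-1] this says that [g * u^-1] and [u^-1 * g^-1], whose product is the square
    of [v^-1], multiply without cancellation. *)
Lemma conj_reduced_lcoprime g u : cycred u ->
  len S (g * u * g^-1) = (len S g + len S u + len S g)%N ->
  lcoprime (u * g^-1) (u^-1 * g^-1).
Proof.
move=> cr l.
have l1 := lenM hG g u; have l2 := lenM hG (g * u) g^-1.
have l3 := lenM hG u g^-1; have l4 := lenM hG g (u * g^-1).
rewrite (gmulA g) in l4; rewrite (lenV hG) in l2 l3.
have a1 : geod g u by apply/geodE; len_lia.
have a2 : geod u g^-1 by apply/geodE; rewrite (lenV hG); len_lia.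
have a3 : geod g (u * g^-1) by apply/geodE; rewrite gmulA; len_lia.
have a4 := geodV a1.
move=> d /[dup] dug /(starts_split a2) [du|[du dg]];
  apply/negP => /(starts_split a4) [dV|[dV dg']].
- by have := cr d du; rewrite dV.
- by move: dV; rewrite indep_allV => /indep_all_nstarts; rewrite du.
- by move: du; rewrite -indep_allV => /indep_all_nstarts; rewrite dV.
- by have /lcoprime_geodP/(_ d dg) := a3; rewrite dug.
Qed.

(** Write [v = g * u * g^-1] without cancellation. The meet of [v^-1] and its square is
    [g * u^-1 * m], where [m] is the meet of [g^-1] and [u^-1 * g^-1], so the exponent equals
    [g * m]. Here [m] and [u^-1] are prefixes of the same element without common first letter, so
    [m] commutes with [u] and the conjugate is [u]. *)
Lemma cycred_phi v : cycred (v ^ (v * meet S v^-1 (v^-1 * v^-1))).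
Proof.
have [g [u [vE l cr]]] := conj_reduce v; rewrite vE in l.
have VE : v^-1 = g * u^-1 * g^-1 by rewrite vE !invgM invgK mulgA.
have lV : len S (g * u^-1 * g^-1) = (len S g + len S u^-1 + len S g)%N.
  by rewrite -VE !(lenV hG) vE.
have VVE : v^-1 * v^-1 = g * u^-1 * (u^-1 * g^-1).
  by rewrite VE !gmulA mulgVK.
have l1 := lenM hG g u^-1; have l2 := lenM hG (g * u^-1) g^-1.
rewrite (lenV hG) in l2.
have a1 : geod g u^-1 by apply/geodE; len_lia.
have a2 : geod (g * u^-1) g^-1 by apply/geodE; rewrite (lenV hG g); len_lia.
have a3 : geod (g * u^-1) (u^-1 * g^-1).
  apply/lcoprime_geodP; rewrite invgM invgK; exact: conj_reduced_lcoprime.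
have [m [x' [y' [gE ugE mx my n]]]] := ex_gcd hG g^-1 (u^-1 * g^-1).
rewrite gE in a2; rewrite ugE in a3.
have [_ a5] := geod_assocV mx a2; have [_ a6] := geod_assocV my a3.
have -> : meet S v^-1 (v^-1 * v^-1) = g * u^-1 * m.
  rewrite VVE ugE VE gE !(gmulA (g * u^-1)); exact: meet_gcd n.
have -> : v * (g * u^-1 * m) = g * m by rewrite vE !gmulA mulgVK mulgK.
have um : ortho m u^-1.
  have a7 := geodV (proj1 (geod_assoc a1 a2)).
  apply: (pre_ortho (z := u^-1 * g^-1)); first by rewrite ugE; exact: pre_geod.
    have : geod u^-1 g^-1 by rewrite gE; case: (geod_assoc a1 a2).
    exact: pre_geod.
  move=> d /(starts_pre (pre_geod mx)); rewrite -gE => dg.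
  by move/lcoprime_geodP: a1 => /(_ d dg).
have -> : v ^ (g * m) = u ^ m by rewrite vE conjgM !conjgE -!gmulA !mulKg.
have /ortho_commute/commuteV := um; rewrite invgK => mu.
by rewrite conjgE -mu mulKg.
Qed.

End Cyclic.

(** * Centralizers *)

Section Centralizer.
Variables (G : groupType) (S : set G).
Hypothesis hG : is_raag [set: G] S.
Implicit Types (c d : (G * bool)%type) (u v w x y z m r g p q t : G) (A : set G).

Local Notation pre := (prec S).
Local Notation rw := (rw hG).
Local Notation geod := (geod hG).
Local Notation starts := (starts hG).
Local Notation indep_all := (indep_all hG).
Local Notation ortho := (ortho hG).
Local Notation within := (within hG).
Local Notation cycred := (cycred hG).
Local Notation supp := (supp hG).

(** With [v = w ^ x], the map [phi S w] multiplies [x] on the right by the exponent of [cycred_phi].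
    If [v] is cyclically reduced, the meet there is [v^-1] and [x] is fixed. *)
Lemma X_cycredP w a : X S w a <-> cycred (w ^ a).
Proof.
have phiE x : phi S w x =
    x * (w ^ x * meet S (w ^ x)^-1 ((w ^ x)^-1 * (w ^ x)^-1)).
  rewrite /phi /median.
  have -> : (w * x)^-1 * x = (w ^ x)^-1 by rewrite conjgE !invgM invgK.
  have -> : (w * x)^-1 * (w^-1 * x) = (w ^ x)^-1 * (w ^ x)^-1.
    by rewrite conjgE !invgM invgK !gmulA mulgK.
  by rewrite conjgE !gmulA mulgV mul1g.
split=> [[x _ <-]|cr]; first by rewrite phiE conjgM; exact: cycred_phi.
exists a => //; rewrite phiE.
have /cycred_geodP/pre_geod/(meet_pre hG) -> := cycredV cr.
by rewrite mulgV mulg1.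
Qed.

(* Otherwise x^-1 w x is geodesic, so x^-1 is a prefix of w ^ x and of its inverse. *)
Lemma cycred_conj_starts w x : cycred w -> cycred (w ^ x) -> x <> 1 ->
  exists2 c, starts c x & [\/ starts c w, starts c w^-1 | indep_all c w].
Proof.
move=> cr crx x1; apply: contrapT => no.
have h c : starts c x -> [/\ ~~ starts c w, ~~ starts c w^-1 & ~~ indep_all c w].
  move=> cx; split; apply/negP => k; apply: no; exists c => //.
  - by constructor 1.
  - by constructor 2.
  - by constructor 3.
have axw : geod x^-1 w by apply: lcoprime_geod => c /h[].
have awx : geod w^-1 x.
  by apply: lcoprime_geod; apply: lcoprimeC => c /h[].
have a : geod (x^-1 * w) x.
  apply/lcoprime_geodP; rewrite invgM invgK; apply: lcoprimeC => c /h[n1 n2 n3].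
  apply/negP => /(starts_split awx) [|[]]; first exact/negP.
  by rewrite indep_allV (negbTE n3).
have [axx axwx] := geod_assoc axw a.
have x1' : x^-1 <> 1 by move=> /(congr1 (@inv G)); rewrite invgK invg1.
have [c cx] := ex_starts hG x1'.
have cw : starts c (w ^ x) by apply: starts_pre cx; exact: pre_geod.
suff cV : starts c (w ^ x)^-1 by have := crx c cw; rewrite cV.
have aV := geodV a; apply: starts_pre cx.
have -> : (w ^ x)^-1 = x^-1 * (x^-1 * w)^-1 by rewrite conjgE !invgM invgK gmulA.
exact: pre_geod.
Qed.

(** Let [w = c w'] and [v = w' c]. The cube of [w] is [c v v w'], and its full length leaves no room
    for cancellation in [v v]; the square of [w] would not contain two copies of [v]. *)
Lemma cycred_rotate w c : cycred w -> starts c w ->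
  [/\ cycred (w ^ lval c), rw (w ^ lval c) =i rw w & len S (w ^ lval c) = len S w].
Proof.
move=> cr cw; have Sc := starts_over cw; have lw := len_starts cw;
  have aw := starts_geod cw.
set w' := (lval c)^-1 * w in lw aw.
have wE : w = lval c * w' by rewrite mulVKg.
have vE : w ^ lval c = w' * lval c by rewrite conjgE /w' gmulA.
set v := w ^ lval c in vE *.
have w3 : w ^+ 3 = lval c * (v * v) * w' by rewrite !expgS expg0 mulg1 vE {1 2 3}wE !gmulA.
have l3 := cycred_len 3 cr; rewrite w3 in l3.
have l4 := lenM hG (lval c * (v * v)) w'; have l5 := lenM hG (lval c) (v * v).
have l6 := lenM hG v v; have l7 := lenM hG w' (lval c).
rewrite -vE (len_lval hG Sc) in l7; rewrite (len_lval hG Sc) in l5.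
have lv : len S v = len S w by len_lia.
split=> //; first by apply/cycred_geodP/geodE; len_lia.
have a : geod w' (lval c) by apply/geodE; rewrite -vE (len_lval hG Sc); len_lia.
by move=> d; rewrite vE (mem_rw_geod _ a) [in RHS]wE (mem_rw_geod _ aw) orbC.
Qed.

Lemma within_eq w v : rw v =i rw w -> within (supp w) v.
Proof. by move=> h c cv; apply/suppE; rewrite -h cv. Qed.

(** A letter starting [w^-1] rotates the other end of [w], which is [cycred_rotate] for [w^-1].
    Supports are compared here because inversion flips the signs of letters. *)
Lemma supp_rotate w c : cycred w -> starts c w \/ starts c w^-1 ->
  [/\ cycred (w ^ lval c), within (supp w) (w ^ lval c), within (supp (w ^ lval c)) w &
      within (supp w) (lval c)].
Proof.
move=> cr cw.
have lc : starts c w \/ starts c w^-1 -> within (supp w) (lval c).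
  move=> h d; rewrite (teq_mem (rw_lval hG _)); last by case: h => /starts_over.
  rewrite inE => /eqP ->; apply/suppE; rewrite -mem_rwV.
  by case: h => /starts_mem -> //; rewrite orbT.
split; last exact: lc.
- case: cw => [cw|cw]; first by case: (cycred_rotate cr cw).
  have [h _ _] := cycred_rotate (cycredV cr) cw.
  by rewrite -(invgK (_ ^ _)) -conjVg; exact: cycredV.
- by rewrite conjgE; apply: withinM; [apply: withinV|apply: withinM;
  [exact: within_supp|]]; exact: lc.
- case: cw => [cw|cw]; first by case: (cycred_rotate cr cw) => _ h _;
  apply: within_eq => d; rewrite h.
  have [_ h _] := cycred_rotate (cycredV cr) cw.
  have h1 : within (supp (w ^ lval c)) (w ^ lval c)^-1 by apply: withinV;
    exact: within_supp.
  apply: within_trans h1 _; rewrite -conjVg.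
  apply: (@within_trans _ _ _ _ w^-1); last exact: within_suppV.
  by apply: within_eq => d; rewrite h.
Qed.

(* For w cyclically reduced, this amounts to membership in X_{w,1}. *)
Definition axial w y := exists n k, pre (w ^+ n * y) (w ^+ k).

Lemma axial_supp w y : axial w y -> within (supp w) y.
Proof.
move=> [n [k h]]; rewrite -(mulKg (w ^+ n) y); apply: withinM.
  by apply: withinV; apply: withinX; exact: within_supp.
by apply: within_pre h _; apply: withinX; exact: within_supp.
Qed.

(** Let [v = w ^ c]. Then [w^n c y = c v^n y] lies below [c v^k = w^k c], a prefix of the next power
    of [w] when [c] starts [w]. When [c] starts [w^-1], the prefix [w' = w c] of [w] takes over the
    role of [c], by [w' v^i = w^i w']. *)
Lemma axial_step w c y : cycred w -> starts c w \/ starts c w^-1 ->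
  axial (w ^ lval c) y -> axial w (lval c * y).
Proof.
move=> cr cw [n [k h]]; have [crv _ _ _] := supp_rotate cr cw.
set v := w ^ lval c in h crv.
have vX i : lval c * v ^+ i = w ^+ i * lval c by rewrite -conjXg -conjgC.
case: cw => [cw|cw].
  have lv : len S v = len S w by case: (cycred_rotate cr cw).
  have Sc := starts_over cw; have lw := len_starts cw.
  set w' := (lval c)^-1 * w in lw.
  have wE : w ^+ k.+1 = w ^+ k * lval c * w' by rewrite expgSr gmulA mulgK /w' -?gmulA ?mulVKg.
  have l1 := cycred_len k.+1 cr; have l2 := lenM hG (w ^+ k * lval c) w'.
  have l3 := lenM hG (w ^+ k) (lval c).
  rewrite -wE in l2; rewrite (len_lval hG Sc) in l3.
  have l4 := cycred_len k cr; have l5 := cycred_len k crv; rewrite lv in l5;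
    rewrite mulSn in l1.
  exists n, k.+1.
  have -> : w ^+ n * (lval c * y) = lval c * (v ^+ n * y) by rewrite !gmulA vX.
  apply: (@pre_trans _ _ hG (lval c * v ^+ k)).
    by apply: pre_mull h; apply/geodE; rewrite vX (len_lval hG Sc); len_lia.
  by rewrite vX wE; apply: pre_geod; apply/geodE; rewrite -wE; len_lia.
have Sc := starts_over cw; have lw := len_starts cw.
have lv : len S v = len S w.
  by have [_ _] := cycred_rotate (cycredV cr) cw; rewrite conjVg !(lenV hG).
set w' := w * lval c.
have lw' : len S w = (len S w').+1.
  by rewrite -(lenV hG w) lw -(lenV hG w') invgM.
have wE : w ^+ k.+1 = w ^+ k * w' * (lval c)^-1 by rewrite expgSr /w' -!gmulA mulgV mulg1.
have l1 := cycred_len k.+1 cr; have l2 := lenM hG (w ^+ k * w') (lval c)^-1.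
have l3 := lenM hG (w ^+ k) w'.
rewrite -wE (lenV hG (lval c)) (len_lval hG Sc) in l2.
have l4 := cycred_len k cr; have l5 := cycred_len k crv; rewrite lv in l5;
  rewrite mulSn in l1.
have w'X i : w' * v ^+ i = w ^+ i * w'.
  by rewrite /w' -gmulA vX !gmulA -expgS -expgSr.
exists n.+1, k.+1.
have -> : w ^+ n.+1 * (lval c * y) = w' * (v ^+ n * y).
  by rewrite !gmulA w'X /w' expgSr gmulA.
apply: (@pre_trans _ _ hG (w' * v ^+ k)).
  by apply: pre_mull h; apply/geodE; rewrite w'X; len_lia.
rewrite w'X wE; apply: pre_geod; apply/geodE.
by rewrite -wE (lenV hG (lval c)) (len_lval hG Sc); len_lia.
Qed.

(** A letter independent of [w] goes to [t]; it passes [y], whose letters lie in the support of [w].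
    The comparison of supports brings orthogonality back from a rotated [w] to [w]. *)
Lemma conj_split w x : cycred w -> cycred (w ^ x) -> exists y t,
  [/\ x = y * t, ortho t w, axial w y, within (supp w) (w ^ x) & within (supp (w ^ x)) w].
Proof.
have [n] := ubnP (len S x); elim: n x w => // n IH x w xn cr crx.
have [->|/eqP x1] := eqVneq x 1.
  exists 1, 1; rewrite mulg1 conjg1; split=> //; try exact: within_supp.
    by apply: orthoC; exact: ortho1.
  by exists 0%N, 0%N; rewrite expg0 mulg1; exact: (pre_refl hG).
have [c cx ccase] := cycred_conj_starts cr crx x1.
have lx := len_starts cx; set x' := (lval c)^-1 * x in lx.
have xE : x = lval c * x' by rewrite mulVKg.
have wx : w ^ x = (w ^ lval c) ^ x' by rewrite -conjgM -xE.
have ln : (len S x' < n)%N by len_lia.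
have [cw|aw] : (starts c w \/ starts c w^-1) \/ indep_all c w by case: ccase; tauto.
  have [crc s1 s2 _] := supp_rotate cr cw.
  have [|y [t [x'E otw ax s3 s4]]] := IH x' (w ^ lval c) ln crc; first by rewrite -wx.
  exists (lval c * y), t; rewrite wx; split.
  - by rewrite xE x'E gmulA.
  - exact: ortho_supp otw.
  - exact: axial_step.
  - exact: within_trans s3.
  - exact: within_trans s2.
have wc : w ^ lval c = w by rewrite conjgE -(indep_all_commute aw) mulKg.
rewrite wc in wx; have [|y [t [x'E otw ax s3 s4]]] := IH x' w ln cr; first by rewrite -wx.
have ocw : ortho (lval c) w.
  move=> d e; rewrite (teq_mem (rw_lval hG (starts_over cx))) inE => /eqP ->.
  by move/allP: aw; apply.
exists y, (lval c * t); rewrite wx; split=> //.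
  have oyc : ortho (lval c) y by apply: ortho_supp ocw; exact: axial_supp.
  by rewrite xE x'E !gmulA (ortho_commute oyc).
by apply: orthoC; apply: orthoM; exact: orthoC.
Qed.

(* For w cyclically reduced, this is H_w, see HsubE. *)
Definition centsupp w x := commute w x /\ within (supp w) x.

Lemma ortho_within_eq1 w t : ortho t w -> within (supp w) t -> t = 1.
Proof. by move=> o i; apply: (@ortho_refl _ _ hG); exact: ortho_supp o. Qed.

Lemma centsupp_axial w x : cycred w -> centsupp w x -> axial w x.
Proof.
move=> cr [cwx iw]; have wx : w ^ x = w by rewrite conjgE cwx mulKg.
have [|y [t [xE otw ax _ _]]] := @conj_split w x cr; first by rewrite wx.
suff t1 : t = 1 by rewrite xE t1 mulg1.
apply: ortho_within_eq1 otw _; rewrite -(mulKg y t) -xE.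
by apply: withinM => //; apply: withinV; exact: axial_supp.
Qed.

Lemma centralizer_split w x : cycred w -> commute w x ->
  exists y t, [/\ x = y * t, centsupp w y & ortho t w].
Proof.
move=> cr cwx; have wx : w ^ x = w by rewrite conjgE cwx mulKg.
have [|y [t [xE otw ax _ _]]] := @conj_split w x cr; first by rewrite wx.
exists y, t; split=> //; split; last exact: axial_supp.
have -> : y = x * t^-1 by rewrite xE mulgK.
by apply: commuteM => //; apply: commuteV; apply: commute_sym; exact: ortho_commute otw.
Qed.

Lemma centsupp1 w : centsupp w 1. Proof. by split; [exact: commute1|exact: within1]. Qed.
Lemma centsuppM w x y : centsupp w x -> centsupp w y -> centsupp w (x * y).
Proof. by move=> [? ?] [? ?]; split; [exact: commuteM|exact: withinM]. Qed.
Lemma centsuppV w x : centsupp w x -> centsupp w x^-1.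
Proof. by move=> [? ?]; split; [exact: commuteV|exact: withinV]. Qed.
Lemma centsuppX w x n : centsupp w x -> centsupp w (x ^+ n).
Proof. by move=> [? ?]; split; [exact: commuteX|exact: withinX]. Qed.
Lemma centsupp_refl w : centsupp w w.
Proof. by split;
  [exact: commute_refl|exact: within_supp]. Qed.

Lemma within_convex A : is_convex S [set x | within A x].
Proof.
move=> x y Ax Ay z /= h; rewrite -(mulVKg x z).
by apply: withinM => //; apply: within_pre h _; apply: withinM => //; exact: withinV.
Qed.

Lemma zexpg_within A x n : within A x -> within A (zexpg x n).
Proof. by case: n => n h /=; [|apply: withinV]; exact: withinX. Qed.

(** Elements with letters in the support of [w] form a convex set containing the powers of [w],
    which bounds the closure from above. Conversely, [w^n x] below [w^k] puts [x] into the interval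
    from [w^-n] to [w^k]. *)
Lemma Hsub_centsupp w x : cycred w -> Hsub S w x <-> centsupp w x.
Proof.
move=> cr; split=> [[cwx Xx]|kwx].
  split=> //; apply: Xx; split; first exact: within_convex.
  by move=> _ [n _ <-] /=; rewrite mulg1; apply: zexpg_within; exact: within_supp.
split; first by case: kwx.
have [n [k h]] := centsupp_axial cr kwx => I [convI WI].
have h' : pre (w ^+ n * x) (w ^+ (n + k)).
  by apply: (pre_trans hG h _); apply: cycred_preX; rewrite ?leq_addl.
have Ik : I (w ^+ k) by apply: WI; exists (Posz k); rewrite ?mulg1.
have In : I (w ^- n).
  (* [Negz n] stands for -(n+1), so the exponent 0 has to come from [Posz]. *)
  apply: WI; case: n {h h'} => [|n]; [exists (Posz 0)|exists (Negz n)] => //=.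
    by rewrite !expg0 invg1 mulg1.
  by rewrite mulg1.
by apply: convI In Ik _ _; rewrite /interval /= invgK -expgnDr.
Qed.

(** * Commuting projections *)

Lemma proj_geod c d x y : ~~ indep c d -> geod x y ->
  proj c d (rw (x * y)) = proj c d (rw x) ++ proj c d (rw y).
Proof. by move=> cd a; rewrite (rw_geod a cd) /proj filter_cat. Qed.

Lemma centsupp_proj w x k c d : cycred w -> centsupp w x -> pre x (w ^+ k) ->
  ~~ indep c d ->
  proj c d (rw x) ++ proj c d (rw w) = proj c d (rw w) ++ proj c d (rw x).
Proof.
move=> cr [cwx _] xw cd.
have a : geod w x by apply: geod_prel xw; exact: cycred_geodX.
have a' : geod x w by apply/geodE; rewrite -cwx addnC; exact/geodE.
by rewrite -!proj_geod // cwx.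
Qed.

(** Both products commute with [w], hence with its powers, so each is the prefix of its own length
    of a long power of [w]; and they have the same length. *)
Lemma seq_commute (T : Type) (u v w : seq T) : (0 < size w)%N ->
  u ++ w = w ++ u -> v ++ w = w ++ v -> u ++ v = v ++ u.
Proof.
move=> w0 uw vw; pose W n := flatten (nseq n w).
have comW (x : seq T) n : x ++ w = w ++ x -> x ++ W n = W n ++ x.
  move=> xw; elim: n => [|n IH]; rewrite /W /= ?cats0 // catA xw -catA.
  by rewrite -/(W n) IH catA.
pose n := (size u + size v)%N.
have sW : (n <= size (W n))%N.
  by rewrite /W size_flatten /shape map_nseq sumn_nseq leq_pmull.
have e (x : seq T) : x ++ w = w ++ x -> size x = n -> x = take n (W n).
  move=> xw sx; have := congr1 (take n) (comW x n xw).
  by rewrite -{1}sx take_size_cat // takel_cat.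
transitivity (take n (W n)); [|symmetry]; apply: e.
- by rewrite -catA vw catA uw catA.
- by rewrite size_cat.
- by rewrite -catA uw catA vw catA.
- by rewrite size_cat addnC.
Qed.

(* Projections of positive elements of H_w commute with that of w, hence with
   each other, since two words commuting with a nonempty word commute. *)
Lemma centsupp_abelian w x y : cycred w -> centsupp w x -> centsupp w y -> commute x y.
Proof.
move=> cr kx ky.
have pos a b n k : centsupp w a -> centsupp w b -> pre a (w ^+ n) -> pre b (w ^+ k) ->
    commute a b.
  move=> ka kb an bk; rewrite /commute -(rw_eval hG a) -(rw_eval hG b) -!eval_cat.
  apply: teq_eval => c d cd; rewrite /proj !filter_cat -!/(proj c d _).
  have [w0|w0] := posnP (size (proj c d (rw w))); last first.
    by apply: (seq_commute w0); [apply: centsupp_proj an _|apply: centsupp_proj bk _].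
  (* If [w] has no letter in the pair, neither has a prefix of a power of [w], and both projections
     are empty. *)
  have nil z i : pre z (w ^+ i) -> proj c d (rw z) = [::].
    move=> zi; apply/eqP; rewrite -[_ == _]negbK -has_filter; apply/hasPn => e ez.
    have ew : e \in rw w.
      elim: i zi => [|i IH] zi; first by have := mem_rw_pre zi ez; rewrite expg0 rw1.
      have := mem_rw_pre zi ez.
      rewrite expgS mem_rw_geod; last exact: cycred_geodX.
      case/orP => // ewi; elim: i {IH zi} ewi => [|i IH]; first by rewrite rw1.
      by rewrite expgS mem_rw_geod; [case/orP|exact: cycred_geodX].
    move/size0nil/eqP: w0; rewrite -[_ == _]negbK -has_filter => /hasPn; exact.
  by rewrite (nil a n) // (nil b k).
(* Powers of [w] commute with [x] and [y], so both may be shifted below powers of [w]. *)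
have [n [n' hx]] := centsupp_axial cr kx; have [k [k' hy]] := centsupp_axial cr ky.
have cn i z : centsupp w z -> commute (w ^+ i) z.
  by move=> [cz _]; apply/commute_sym/commuteX/commute_sym.
have h : commute (w ^+ n * x) (w ^+ k * y).
  by apply: pos hx hy; apply: centsuppM => //; apply: centsuppX; exact: centsupp_refl.
have h1 : commute (w ^+ n * x) y.
  rewrite -(mulKg (w ^+ k) y); apply: commuteM => //.
  by apply: commuteV; apply/commute_sym/cn/centsuppM => //; apply/centsuppX/centsupp_refl.
apply: commute_sym; rewrite -(mulKg (w ^+ n) x); apply: commuteM; last exact: commute_sym.
by apply: commuteV; apply/commute_sym/cn.
Qed.

(* With m the meet, x = m x' and y = m y', the elements x' and y' are orthogonal,
   so on two dependent letters m projects to the projection of x or of y. *)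
Lemma centsupp_meet_pos w x y k : cycred w -> centsupp w x -> centsupp w y ->
  pre x (w ^+ k) -> pre y (w ^+ k) -> centsupp w (meet S x y).
Proof.
move=> cr kx ky xk yk.
have [x' [y' [xE yE mx my n]]] := meetP hG x y.
set m := meet S x y in xE yE mx my *.
split; last by apply: within_pre (_ : within _ x); [rewrite xE; exact: pre_geod|case: kx].
have o : ortho x' y'.
  have mk : pre m (w ^+ k) by apply: (pre_trans hG _ xk); rewrite xE; exact: pre_geod.
  move: mk xk yk => /(preP hG) [r -> ar]; rewrite xE yE => h1 h2.
  by apply: (@pre_ortho _ _ hG _ _ r _ _ n); apply: (pre_mullI (z := m)).
rewrite /commute -(rw_eval hG m) -{1 2}(rw_eval hG w) -!eval_cat.
apply: teq_eval => c d cd; rewrite /proj !filter_cat -!/(proj c d _).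
have pm z z' : z = m * z' -> geod m z' -> proj c d (rw z') = [::] ->
    proj c d (rw m) = proj c d (rw z).
  by move=> -> a p0; rewrite proj_geod // p0 cats0.
have [x0|] := eqVneq (proj c d (rw x')) [::].
  by rewrite (pm x x') // (centsupp_proj cr kx xk).
rewrite -has_filter => /hasP[e ex ecd].
rewrite (pm y y') //; first by rewrite (centsupp_proj cr ky yk).
apply/eqP; rewrite -[_ == _]negbK -has_filter; apply/hasP => -[f fy fcd].
have := o _ _ ex fy; move: cd; case/orP: ecd => /eqP->; case/orP: fcd => /eqP->;
  rewrite ?indep_irr ?[indep d c]indepC //.
  by move=> /negbTE->.
by move=> /negbTE->.
Qed.

End Centralizer.

(** * Primitive factors *)

Section Zexpg.
Variable G : groupType.
Implicit Types x y : G.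

(** Integer powers are handled as quotients of natural ones. The second clause turns a vanishing
    exponent into equality of two letter counts in [free_abelian_raag]. *)
Lemma zexpg_quot x m n :
  exists2 i, x ^+ m * x ^- n = zexpg x i & i = Posz 0 -> m = n.
Proof.
have [nm|mn] := leqP n m.
  by exists (Posz (m - n)); rewrite /= ?expgnFr // => -[]; lia.
exists (Negz (n - m).-1) => //=; rewrite prednK ?subn_gt0 //.
by rewrite expgnFr 1?ltnW // invgM invgK.
Qed.

Lemma zexpgE x i : exists m n, zexpg x i = x ^+ m * x ^- n.
Proof.
by case: i => k; [exists k, 0%N; rewrite expg0 invg1 mulg1|
  exists 0%N, k.+1; rewrite expg0 mul1g].
Qed.

Lemma commute_zexpg x y i : commute x y -> commute x (zexpg y i).
Proof.
by move=> xy; case: i => k /=; [exact: commuteX|apply: commuteV; exact: commuteX].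
Qed.

Lemma conj_zexpg x y i : zexpg x i ^ y = zexpg (x ^ y) i.
Proof. by case: i => k /=; rewrite ?conjVg conjXg. Qed.

Lemma zexpg_subgroup x : is_subgroup [set zexpg x n | n in [set: int]].
Proof.
split; first by exists (Posz 0).
  move=> _ _ [i _ <-] [j _ <-].
  have [a [b ->]] := zexpgE x i; have [c [d ->]] := zexpgE x j.
  have [k kE _] := zexpg_quot x (a + c) (b + d); exists k => //; rewrite -kE.
  rewrite expgnDr [(b + d)%N]addnC expgnDr invgM -!mulgA; congr (_ * _);
    rewrite !mulgA; congr (_ * _).
  exact: (commuteV (commuteX2 c b (commute_refl x))).
move=> _ [i _ <-]; have [a [b ->]] := zexpgE x i.
by have [k kE _] := zexpg_quot x b a; exists k => //; rewrite -kE invgM invgK.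
Qed.

Lemma generated_subgroup (A : set G) : is_subgroup (generated A).
Proof.
split; first by move=> H [[]].
  move=> x y hx hy H hH; have [[_ hM _] _] := hH.
  by apply: hM; [exact: hx|exact: hy].
by move=> x hx H hH; have [[_ _ hV] _] := hH; apply: hV; exact: hx.
Qed.

Lemma generated_sub (A : set G) : A `<=` generated A.
Proof. by move=> x Ax H [_]; apply. Qed.

Lemma subgroup_zexpg (H : set G) x i : is_subgroup H -> H x -> H (zexpg x i).
Proof.
move=> [h1 hM hV] Hx.
have hX n : H (x ^+ n) by elim: n => // n IH; rewrite expgS; exact: hM.
by case: i => k /=; [|apply: hV].
Qed.

End Zexpg.

Section Primitive.
Variables (G : groupType) (S : set G).
Hypothesis hG : is_raag [set: G] S.
Implicit Types (c d : (G * bool)%type) (u v w x y z g p q t : G) (A B : set G) (m n : nat).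

Local Notation pre := (prec S).
Local Notation rw := (rw hG).
Local Notation geod := (geod hG).
Local Notation starts := (starts hG).
Local Notation ortho := (ortho hG).
Local Notation within := (within hG).
Local Notation cycred := (cycred hG).
Local Notation supp := (supp hG).
Local Notation centsupp := (centsupp hG).

Lemma ortho_within u v x y : ortho u v -> within (supp u) x -> within (supp v) y ->
  ortho x y.
Proof. by move=> o hx hy; apply: ortho_supp hy _; apply: orthoC;
  apply: ortho_supp hx _; exact: orthoC. Qed.

Lemma within_lval A c : S c.1 -> A c.1 -> within A (lval c).
Proof. by move=> Sc Ac d; rewrite (teq_mem (rw_lval hG Sc)) inE => /eqP ->. Qed.

Lemma within_split A B z :
  (forall x y, within A x -> within B y -> commute x y) -> within (A `|` B) z ->
  exists z1 z2, [/\ z = z1 * z2, within A z1 & within B z2].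
Proof.
move=> AB; rewrite -{2}(rw_eval hG z).
have : word_over S (rw z) by exact: rw_over.
have -> : within (A `|` B) z = word_over (A `|` B) (rw z) by [].
elim: (rw z) => [_ _|c u IH Scu ABcu].
  by exists 1, 1; rewrite eval_nil mulg1; split=> //; exact: within1.
have [|d du|z1 [z2 [uE h1 h2]]] := IH.
- by move=> d du; apply: Scu; rewrite in_cons du orbT.
- by apply: ABcu; rewrite in_cons du orbT.
have Sc : S c.1 by apply: Scu; rewrite mem_head.
rewrite eval_cons uE; case: (ABcu c (mem_head _ _)) => [Ac|Bc].
  by exists (lval c * z1), z2; rewrite mulgA; split => //; apply: withinM => //;
    exact: within_lval.
have hc := within_lval Sc Bc; exists z1, (lval c * z2); split=> //; last exact: withinM.
by rewrite !mulgA (AB _ _ h1 hc).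
Qed.

Lemma supp_split u v z : ortho u v -> within (supp (u * v)) z ->
  exists z1 z2, [/\ z = z1 * z2, within (supp u) z1 & within (supp v) z2].
Proof.
move=> o h; apply: within_split => [x y hx hy|];
  first exact: ortho_commute (ortho_within o hx hy).
move=> [s b] /h [b' /mem_rwM]; rewrite mem_cat => /orP[k|k]; [left|right]; by exists b'.
Qed.

(** The quotient [t] measures the failure of [z1] to commute with [u] and has letters in the support
    of [u]. As [z] commutes with [u * v], it also measures the failure of [z2] to commute with [v],
    so it is orthogonal to itself and trivial. *)
Lemma centsupp_split u v z : ortho u v -> centsupp (u * v) z ->
  exists z1 z2, [/\ z = z1 * z2, centsupp u z1 & centsupp v z2].
Proof.
move=> o [cz /(supp_split o) [z1 [z2 [zE h1 h2]]]].
have o12 := ortho_within o h1 h2; have o1v := ortho_within o h1 (@within_supp _ _ hG v).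
have ou2 := ortho_within o (@within_supp _ _ hG u) h2.
pose t := (u * z1)^-1 * (z1 * u).
have tE : t = (v * z2) * (z2 * v)^-1.
  apply: (@mulgI _ (u * z1)); rewrite mulVKg; apply: (@mulIg _ (z2 * v)).
  rewrite -!gmulA mulVg mulg1 (gmulA u z2) (ortho_commute ou2) (gmulA z1 v).
  move: cz; rewrite /commute zE (ortho_commute o1v) -!gmulA => ->.
  by [].
have t1 : t = 1.
  apply: (@ortho_refl _ _ hG); apply: (ortho_within o).
    by apply: withinM; [apply: withinV|]; apply: withinM => //; exact: within_supp.
  by rewrite tE; apply: withinM; [|apply: withinV]; apply: withinM => //;
    exact: within_supp.
exists z1, z2; split=> //; split=> //.
  by rewrite /commute -(mulVKg (u * z1) (z1 * u)) -/t t1 mulg1.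
by move: tE; rewrite t1 => /esym/divg1_eq.
Qed.

(** The Abelian group attached to [p ^+ n] contains [p] as well as [z]. *)
Lemma centsupp_expI p z n : cycred p -> (0 < n)%N -> centsupp (p ^+ n) z -> centsupp p z.
Proof.
move=> cr n0 kz; split.
  have kp : centsupp (p ^+ n) p.
    split; last exact: within_suppX.
    by apply: commute_sym; apply: commuteX; exact: commute_refl.
  exact: centsupp_abelian (cycredX cr) kp kz.
case: kz => _; apply: within_trans; apply: withinX; exact: within_supp.
Qed.

Lemma cycred_ortho u v : ortho u v -> cycred (u * v) -> cycred u /\ cycred v.
Proof.
move=> o /cycred_geodP/geodE; have /geodE -> := ortho_geod o.
have -> : u * v * (u * v) = u * u * (v * v).
  by rewrite -!gmulA; congr (_ * _); rewrite !gmulA (ortho_commute o).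
move=> l; have l1 := lenM hG (u * u) (v * v).
have l2 := lenM hG u u; have l3 := lenM hG v v.
by split; apply/cycred_geodP/geodE; len_lia.
Qed.

(* For p cyclically reduced, this is primitive S p, see primitiveP. *)
Definition prim_cycred p := [/\ p <> 1, cycred p & forall z, centsupp p z ->
  exists i, z = zexpg p i].

Lemma centsupp_zexpg p i : centsupp p (zexpg p i).
Proof.
split; first by apply: commute_zexpg; exact: commute_refl.
by apply: zexpg_within; exact: within_supp.
Qed.

Lemma len_zexpg p i : cycred p -> len S (zexpg p i) = (`|i| * len S p)%N.
Proof. by move=> cr; case: i => k /=; rewrite ?(lenV hG) cycred_len. Qed.

Lemma len_gt0 p : p <> 1 -> (0 < len S p)%N.
Proof. by move=> p1; rewrite lt0n; apply/eqP => /(len_eq0 hG). Qed.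

Lemma within_supp_zexpg p i : cycred p -> zexpg p i <> 1 -> within (supp (zexpg p i)) p.
Proof.
move=> cr; case: i => [[|k]|k] //= _; first exact: within_suppX.
by apply: (@within_trans _ _ _ _ (p ^+ k.+1)); [exact: within_suppV|exact: within_suppX].
Qed.

(* p is a shortest nontrivial prefix of w commuting with w; a meet with p that
   commutes with w is then 1 or p. *)
Lemma ex_prim_cycred w : cycred w -> w <> 1 -> exists p m w',
  [/\ prim_cycred p, (0 < m)%N, w = p ^+ m * w' & ortho p w'].
Proof.
move=> cr w1; pose Q z := [/\ z <> 1, pre z w & commute w z].
have : exists n, `[< exists2 z, Q z & len S z = n >].
  exists (len S w); apply/asboolP; exists w => //; split=> //; exact: (pre_refl hG).
case/ex_minnP => n /asboolP[p [p1 pw cwp] lp] min.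
have minp z : Q z -> pre z p -> z = p.
  move=> qz zp; apply: (pre_eq hG zp); rewrite lp; apply: min.
  by apply/asboolP; exists z.
(* As [w = p r = r p], the square of [w] is [r p p r]; it has full length, so [p p] has no
   cancellation. *)
have crp : cycred p.
  have [r wE a] := preP hG pw.
  have pr : commute p r.
    by apply: (@mulgI _ p); rewrite -wE -cwp {1}wE gmulA.
  have /geodE l := (cycred_geodP _ _).1 cr.
  have e : w * w = r * (p * p) * r by rewrite {1}wE pr wE !gmulA.
  move/geodE: a; rewrite -wE => a; rewrite e in l.
  have l1 := lenM hG (r * (p * p)) r; have l2 := lenM hG r (p * p).
  have l3 := lenM hG p p.
  by apply/cycred_geodP/geodE; len_lia.
(* Once [p] is divided out as often as possible, its meet with the remainder is not [p], so it is
   trivial by minimality. *)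
have [m [w' [m0 wE a npw]]] : exists m w',
    [/\ (0 < m)%N, w = p ^+ m * w', geod (p ^+ m) w' & ~ pre p w'].
  have : exists m w', [/\ (0 < m)%N, w = p ^+ m * w' & geod (p ^+ m) w'].
    by have [r wE ar] := preP hG pw; exists 1%N, r.
  case=> m [w' [m0 wE a]]; have [k] := ubnP (len S w').
  elim: k m w' m0 wE a => // k IH m w' m0 wE a lk.
  have [h|] := pselect (pre p w'); last by exists m, w'.
  have [r w'E ar] := preP hG h.
  apply: (IH m.+1 r) => //; first by rewrite expgSr -gmulA -w'E.
    by move: a; rewrite w'E expgSr => a; have [] := geod_assocV ar a.
  have /geodE := ar; rewrite -w'E; have := len_gt0 p1; len_lia.
have cwpm : commute w (p ^+ m) by exact: commuteX.
have w'E : w' = p ^- m * w by rewrite wE mulKg.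
have cww' : commute w w'.
  by rewrite w'E; apply: commuteM; [exact: commuteV|exact: commute_refl].
have w'w : pre w' w.
  have wE' : w = w' * p ^+ m.
    by rewrite w'E -gmulA cwpm mulKg.
  rewrite wE'; apply: pre_geod; apply/geodE; rewrite -wE' {1}wE addnC; exact/geodE.
have kp : centsupp w p by split=> //; apply: within_pre pw _; exact: within_supp.
have kw' : centsupp w w' by split=> //; apply: within_pre w'w _; exact: within_supp.
have opw' : ortho p w'.
  apply: (pre_ortho pw w'w); apply/meet1P.
  have e := centsupp_meet_pos (k := 1) cr kp kw' pw w'w.
  have [x' [y' [pE w'E' ap aw' _]]] := meetP hG p w'.
  set r := meet S p w' in e pE w'E' ap aw' *.
  apply: contrapT => r1; apply: npw.
  have rp : pre r p by rewrite pE; exact: pre_geod.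
  have <- : r = p.
    by apply: minp => //; split=> //; [exact: (pre_trans hG rp pw)|case: e].
  by rewrite w'E'; exact: pre_geod.
exists p, m, w'; split=> //; split=> // z kz.
(* The meet of [p] with [x] commutes with [w], because elements in the support of [p] commute with
   [w']. If it is 1, then [x] is orthogonal to [p] and trivial; if it is [p], a factor [p] is
   divided out of [x]. *)
have pos x k : centsupp p x -> pre x (p ^+ k) -> exists i, x = p ^+ i.
  have [b] := ubnP (len S x); elim: b x => // b IH x lb kx xk.
  have pk : pre p (p ^+ k.+1) by rewrite -{1}(expg1 p); exact: cycred_preX.
  have xk' : pre x (p ^+ k.+1) by apply: (pre_trans hG xk); exact: cycred_preX.
  have e := centsupp_meet_pos crp (centsupp_refl hG p) kx pk xk'.
  have [x' [y' [pE xE ap ax nn]]] := meetP hG p x.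
  have mp := pre_geod ap; rewrite -pE in mp.
  have [m1|/eqP m1] := eqVneq (meet S p x) 1.
    have o : ortho p x by apply: (pre_ortho pk xk'); exact/meet1P.
    exists 0%N; rewrite expg0; by case: kx => _; exact: (ortho_within_eq1 (orthoC o)).
  have mE : meet S p x = p.
    apply: minp => //; split=> //; first exact: (pre_trans hG mp pw).
    case: e => ce ie; rewrite wE; apply: commute_sym; apply: commuteM.
      by apply: commuteX; exact: commute_sym.
    exact: (ortho_commute (orthoC (ortho_supp ie (orthoC opw')))).
  rewrite mE in xE ax; have /geodE lx := ax; rewrite -xE in lx.
  have ky : centsupp p y'.
    have -> : y' = p^-1 * x by rewrite xE mulKg.
    by apply: centsuppM => //; apply: centsuppV; exact: centsupp_refl.
  have xE' : x = y' * p by case: ky => c _; rewrite xE c.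
  have [||i yE] := IH y' _ ky; last by exists i.+1; rewrite xE yE expgS.
    by have := len_gt0 p1; len_lia.
  apply: (pre_trans hG _ xk); rewrite xE'; apply: pre_geod; apply/geodE.
  by rewrite -xE' lx addnC.
have [i [k h]] := centsupp_axial crp kz.
have [|j jE] := pos _ _ _ h; first by apply: centsuppM => //; apply: centsuppX;
  exact: centsupp_refl.
have -> : z = p ^- i * p ^+ j by rewrite -jE mulKg.
have [h1 hM hV] := zexpg_subgroup p.
have [] : [set zexpg p n | n in [set: int]] (p ^- i * p ^+ j).
  by apply: hM; [apply: hV; exists (Posz i)|exists (Posz j)].
by move=> r _ <-; exists r.
Qed.

(* For w cyclically reduced, this is Prim S w, see Prim_prim_factor. *)
Definition prim_factor w p := prim_cycred p /\ exists m w', [/\ (0 < m)%N, w =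
  p ^+ m * w' & ortho p w'].

(** Induction along the orthogonal splitting: the remainder [w'] is again cyclically reduced, and
    shorter. *)
Lemma prim_ind (P : G -> Prop) : P 1 ->
  (forall w p m w', cycred w -> w = p ^+ m * w' -> (0 < m)%N -> prim_cycred p ->
    ortho p w' ->
     cycred w' -> P w' -> P w) ->
  forall w, cycred w -> P w.
Proof.
move=> P1 PM w; have [n] := ubnP (len S w); elim: n w => // n IH w wn cr.
have [->//|/eqP w1] := eqVneq w 1.
have [p [m [w' [pp m0 wE o]]]] := ex_prim_cycred cr w1.
have opm : ortho (p ^+ m) w' by apply: orthoC; apply: orthoX; exact: orthoC.
have [_ cr'] : cycred (p ^+ m) /\ cycred w' by apply: cycred_ortho; rewrite -?wE.
apply: (PM w p m w') => //; apply: IH => //.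
have /geodE := ortho_geod opm; rewrite -wE; case: pp => p1 crp _.
rewrite cycred_len //; have := len_gt0 p1; case: m m0 {wE opm} => // m _; rewrite mulSn.
len_lia.
Qed.

Lemma orthoXl p n v : ortho p v -> ortho (p ^+ n) v.
Proof. by move=> o; apply: orthoC; apply: orthoX; exact: orthoC. Qed.

Lemma prim_factor_centsupp w q : prim_factor w q -> centsupp w q.
Proof.
move=> [[_ cr _] [m [w' [m0 -> o]]]]; split.
  apply: commute_sym; apply: commuteM; last exact: (ortho_commute o).
  by apply: commuteX; exact: commute_refl.
apply: (@within_trans _ _ _ _ (q ^+ m)); last exact: within_suppX.
by apply: within_pre (@within_supp _ _ hG _); apply: pre_geod; apply: ortho_geod;
  exact: orthoXl.
Qed.

Lemma prim_factor1 q : ~ prim_factor 1 q.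
Proof.
move=> /[dup] /prim_factor_centsupp [_ q1] [[nq _ _] _]; apply: nq.
by apply: (@ortho_within_eq1 _ _ hG 1) q1; exact: ortho1.
Qed.

(** A factor [q] splits as [q1 * q2] along the two supports. If [q1] is trivial, [q] belongs to
    [w']. Otherwise [q1] is a power of [q], so [q2] is trivial and [p], [q] are powers of each
    other; comparing lengths leaves [p] and [p^-1]. *)
Lemma prim_factor_mul p m w' q : cycred (p ^+ m * w') -> (0 < m)%N -> prim_cycred p ->
  ortho p w' ->
  prim_factor (p ^+ m * w') q <-> q = p \/ prim_factor w' q.
Proof.
move=> cr m0 pp o; have [p1 crp genp] := pp.
have opm := @orthoXl p m w' o; split; last first.
  case=> [->|fq]; first by split=> //; exists m, w'.
  have opq : ortho p q by apply: ortho_within o (@within_supp _ _ hG p) _;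
    case: (prim_factor_centsupp fq).
  case: fq => pq [k [w'' [k0 w'E oq]]]; split=> //; exists k, (p ^+ m * w''); split=> //.
    rewrite w'E !gmulA; congr (_ * _); apply: (@ortho_commute _ _ hG).
    by apply: orthoXl; apply: orthoX.
  by apply: orthoM => //; apply: orthoX; exact: orthoC.
move=> fq; have [q1 [q2 [qE k1 k2]]] := centsupp_split opm (prim_factor_centsupp fq).
case: fq => -[nq crq genq] [k [v [k0 wE oq]]].
have {}k1 := centsupp_expI crp m0 k1.
have [[c1 i1] [c2 i2]] := (k1, k2).
have o12 := ortho_within o i1 i2; have c12 := ortho_commute o12.
have kq1 : centsupp q q1.
  split; first by rewrite qE /commute -gmulA c12.
  by apply: within_pre (@within_supp _ _ hG q); rewrite qE; apply: pre_geod;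
    exact: ortho_geod.
have kq2 : centsupp q q2.
  split; first by rewrite qE /commute gmulA -c12.
  by apply: within_pre (@within_supp _ _ hG q); rewrite qE c12; apply: pre_geod;
    apply: ortho_geod; exact: orthoC.
have [q1e|/eqP nq1] := eqVneq q1 1.
  right; rewrite q1e mul1g in qE; rewrite -qE in k2 i2.
  have opq : ortho p q := ortho_within o (@within_supp _ _ hG p) i2.
  split=> //; exists k, (q ^- k * w'); rewrite mulVKg; split=> //.
  have oqp : ortho q (p ^+ m) by apply: orthoX; exact: orthoC.
  have -> : q ^- k * w' = p ^- m * v.
    have -> : v = q ^- k * (p ^+ m * w') by rewrite wE mulKg.
    rewrite !gmulA; congr (_ * _); rewrite -gmulA.
    have /ortho_commute -> : ortho (q ^- k) (p ^+ m).
      by apply: orthoC; apply: orthoV; apply: orthoX; exact: orthoC.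
    by rewrite mulKg.
  by apply: orthoM => //; exact: orthoV.
left; have q2e : q2 = 1.
  have [j q1E] := genq _ kq1.
  have iq : within (supp q1) q by rewrite q1E; apply: within_supp_zexpg; rewrite -?q1E.
  by case: kq2 => _; apply: (ortho_within_eq1 (w := q)); apply: ortho_supp iq _;
    exact: orthoC.
rewrite q2e mulg1 in qE; have [i q1E] := genp _ k1.
rewrite -qE in q1E.
have [r pE] : exists r, p = zexpg q r.
  apply: genq; split; last by rewrite q1E; apply: within_supp_zexpg; rewrite -?q1E.
  by apply: commute_sym; rewrite q1E; apply: commute_zexpg; exact: commute_refl.
have l1 := len_zexpg i crp; have l2 := len_zexpg r crq.
rewrite -q1E in l1; rewrite -pE l1 mulnA in l2.
have i1' : `|i|%N = 1%N.
  have := len_gt0 p1; case: (len S p) l2 => // l l2 _.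
  have /eqP : (`|r| * `|i| = 1)%N by apply/eqP; rewrite -(@eqn_pmul2r l.+1) // mul1n -l2.
  by rewrite muln_eq1 => /andP[_ /eqP].
case: i q1E i1' {l1 l2} => i q1E /= i1'; first by rewrite q1E i1'.
have {}q1E : q = p^-1 by rewrite q1E /=; case: i1' => ->.
(* The case [q = p^-1] is excluded: a first letter of [q] would start [w = q^k v], and also [w^-1],
   which begins with [p^-m]. *)
have [c cq] := ex_starts hG nq.
have qk : pre q (q ^+ k) by rewrite -{1}(expg1 q); exact: cycred_preX.
have cw : starts c (p ^+ m * w').
  rewrite wE; apply: starts_pre cq; apply: (pre_trans hG qk).
  by apply: pre_geod; apply: ortho_geod; exact: orthoXl.
have qm : pre q (q ^+ m) by rewrite -{1}(expg1 q); exact: cycred_preX.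
suff : starts c (p ^+ m * w')^-1 by rewrite (negbTE (cr c cw)).
apply: starts_pre cq; apply: (pre_trans hG qm).
rewrite (ortho_commute opm) invgM q1E expVgn; apply: pre_geod; apply: ortho_geod.
by apply: orthoV; apply: orthoC; apply: orthoV; exact: orthoC.
Qed.

Lemma ortho_prim_factor w x : cycred w -> ortho x w <-> forall p, prim_factor w p ->
  ortho x p.
Proof.
move=> cr; move: w cr; apply: prim_ind.
  by split=> [_ p /prim_factor1|_] //; exact: ortho1.
move=> w p m w' cr wE m0 pp o _ IH; rewrite wE in cr *; split=> [ox_w q|h].
  move=> fq; have [_ iq] := prim_factor_centsupp fq; exact: ortho_supp iq ox_w.
apply: orthoM.
  by apply: orthoX; apply: h; apply/prim_factor_mul => //; left.
by apply/IH => q fq; apply: h; apply/prim_factor_mul => //; right.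
Qed.

Lemma centsupp_subgroup w : is_subgroup (centsupp w).
Proof. by split; [exact: centsupp1|exact: centsuppM|exact: centsuppV]. Qed.

Lemma centsupp_generated w : cycred w -> centsupp w = generated (prim_factor w).
Proof.
move=> cr; apply/seteqP; split; last first.
  apply: smallest_sub; [exact: centsupp_subgroup|exact: prim_factor_centsupp].
move: w cr; apply: prim_ind.
  move=> z [_ iz]; have -> : z = 1 by apply: ortho_within_eq1 iz; exact: ortho1.
  by case: (generated_subgroup (prim_factor 1)).
move=> w p m w' cr wE m0 pp o _ IH z; rewrite wE in cr * => kz.
have [z1 [z2 [-> k1 k2]]] := centsupp_split (@orthoXl p m w' o) kz.
have [p1 crp genp] := pp; have [i ->] := genp _ (centsupp_expI crp m0 k1).
have sg := generated_subgroup (prim_factor (p ^+ m * w')); have [_ hM _] := sg.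
apply: hM.
  by apply: (@subgroup_zexpg _ _ p i sg); apply: generated_sub;
    apply/prim_factor_mul => //; left.
apply: (smallest_sub sg _ (IH _ k2)) => q fq.
by apply: generated_sub; apply/prim_factor_mul => //; right.
Qed.

Lemma prim_factor_ortho w p q : cycred w -> prim_factor w p -> prim_factor w q ->
  p <> q -> ortho p q.
Proof.
move=> cr; move: w cr p q; apply: prim_ind => [p q /prim_factor1//|].
move=> w p m w' cr wE m0 pp o _ IH q r; rewrite wE in cr *.
have h s : prim_factor w' s -> ortho p s.
  by move=> fs; apply: ortho_within o (@within_supp _ _ hG p) _;
    case: (prim_factor_centsupp fs).
move=> /prim_factor_mul-/(_ cr m0 pp o) [->|fq] /prim_factor_mul-/(_ cr m0 pp o) [->|fr] // ne.
- exact: h.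
- by apply: orthoC; exact: h.
- exact: IH.
Qed.

(** Powers of the same sign are comparable, and powers of opposite sign have no common first
    letter. *)
Lemma centsupp_meet_zexpg p i j : cycred p -> centsupp p (meet S (zexpg p i) (zexpg p j)).
Proof.
move=> cr; have kX n : centsupp p (p ^+ n) by apply: centsuppX; exact: centsupp_refl.
have op n k : meet S (p ^+ n) (p ^- k) = 1.
  by apply/(meet1P hG)/lcoprimeC/lcoprime_geodP; exact: cycred_geodXX.
have cmp q n k : cycred q -> meet S (q ^+ n) (q ^+ k) = q ^+ n \/
    meet S (q ^+ n) (q ^+ k) = q ^+ k.
  move=> crq; have [nk|/ltnW kn] := leqP n k.
    by left; apply: (meet_pre hG); exact: cycred_preX.
  by right; rewrite (meetC hG); apply: (meet_pre hG); exact: cycred_preX.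
case: i j => i [] j /=.
- by case: (cmp p i j cr) => ->.
- by rewrite op; exact: centsupp1.
- by rewrite (meetC hG) op; exact: centsupp1.
- rewrite -!expVgn.
  by case: (cmp p^-1 i.+1 j.+1 (cycredV cr)) => ->; rewrite expVgn; apply: centsuppV.
Qed.

(** The cofactors in the two supports are recombined. A first letter common to the recombined
    cofactors would be common to cofactors in one support, or to elements of orthogonal supports. *)
Lemma meet_ortho u v x0 y0 x1 y1 : ortho u v -> within (supp u) x0 ->
  within (supp u) y0 ->
  within (supp v) x1 -> within (supp v) y1 ->
  meet S (x0 * x1) (y0 * y1) = meet S x0 y0 * meet S x1 y1.
Proof.
move=> o hx0 hy0 hx1 hy1.
have [a [b [x0E y0E ea eb nab]]] := meetP hG x0 y0.
have [a' [b' [x1E y1E ea' eb' nab']]] := meetP hG x1 y1.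
set e := meet S x0 y0 in x0E y0E ea eb *; set e' := meet S x1 y1 in x1E y1E ea' eb' *.
have ie : within (supp u) e by apply: within_pre hx0; rewrite x0E; exact: pre_geod.
have ie' : within (supp v) e' by apply: within_pre hx1; rewrite x1E; exact: pre_geod.
have ra z r s A : z = r * s -> within A z -> within A r -> within A s.
  by move=> -> h1 h2; rewrite -(mulKg r s); apply: withinM => //; exact: withinV.
have ia := ra _ _ _ _ x0E hx0 ie; have ib := ra _ _ _ _ y0E hy0 ie.
have ia' := ra _ _ _ _ x1E hx1 ie'; have ib' := ra _ _ _ _ y1E hy1 ie'.
have key z s z' s' : z = e * s -> z' = e' * s' -> geod e s -> geod e' s' ->
    within (supp u) z -> within (supp v) z' -> within (supp u) s ->
    z * z' = e * e' * (s * s') /\ geod (e * e') (s * s').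
  move=> zE z'E a1 a2 iz iz' is0.
  have E : z * z' = e * e' * (s * s').
    rewrite zE z'E -!gmulA; congr (_ * _); rewrite !gmulA; congr (_ * _).
    exact: (ortho_commute (ortho_within o is0 ie')).
  split=> //; apply/geodE; rewrite -E.
  have /geodE l1 := ortho_geod (ortho_within o iz iz').
  have /geodE l2 := a1; have /geodE l3 := a2; rewrite -zE in l2; rewrite -z'E in l3.
  have l4 := lenM hG e e'; have l5 := lenM hG s s'.
  have l6 := lenM hG (e * e') (s * s'); rewrite -E in l6.
  len_lia.
have [-> a1] := key _ _ _ _ x0E x1E ea ea' hx0 hx1 ia.
have [-> a2] := key _ _ _ _ y0E y1E eb eb' hy0 hy1 ib.
apply: (meet_gcd a1 a2) => c.
have aa := ortho_geod (ortho_within o ia ia');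
  have bb := ortho_geod (ortho_within o ib ib').
have oab := ortho_lcoprime (ortho_within o ia ib');
  have oba := ortho_lcoprime (ortho_within o ib ia').
move=> /(starts_split aa) [ca|[_ ca']]; apply/negP => /(starts_split bb) [cb|[_ cb']].
- by have := nab c ca; rewrite cb.
- by have := oab c ca; rewrite cb'.
- by have := oba c cb; rewrite ca'.
- by have := nab' c ca'; rewrite cb'.
Qed.

(** [centsupp_meet_pos] covers only elements below a power of [w]. In general the meet is taken
    factor by factor, where it concerns powers of one primitive element. *)
Lemma centsupp_meet w x y : cycred w -> centsupp w x -> centsupp w y ->
  centsupp w (meet S x y).
Proof.
move=> cr; move: w cr x y; apply: prim_ind => [x y|].
  move=> [_ ix] _; have -> : x = 1 by apply: ortho_within_eq1 ix; exact: ortho1.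
  by rewrite (meet_pre hG (pre1 hG y)); exact: centsupp1.
move=> w p m w' cr wE m0 pp o _ IH x y kx ky; have [p1 crp genp] := pp.
have opm := @orthoXl p m w' o; rewrite wE in kx ky.
have [x0 [x1 [-> kx0 kx1]]] := centsupp_split opm kx.
have [y0 [y1 [-> ky0 ky1]]] := centsupp_split opm ky.
have {}kx0 := centsupp_expI crp m0 kx0; have {}ky0 := centsupp_expI crp m0 ky0.
have [[[[_ i1] [_ i2]] [_ i3]] [_ i4]] := (kx0, ky0, kx1, ky1).
rewrite (meet_ortho o) //.
have kpw : centsupp w p by apply: prim_factor_centsupp; split=> //; exists m, w'.
have Kp z : centsupp p z -> centsupp w z.
  by move=> /genp [i ->]; exact: (subgroup_zexpg i (centsupp_subgroup w)).
have Kw' z : centsupp w' z -> centsupp w z.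
  move=> [cz iz]; rewrite wE; split.
    apply: commute_sym; apply: commuteM; last exact: commute_sym.
    by apply: commuteX; apply: commute_sym; exact: (ortho_commute (ortho_supp iz o)).
  apply: within_trans iz; apply: within_pre (@within_supp _ _ hG _);
    rewrite (ortho_commute opm).
  by apply: pre_geod; apply: ortho_geod; exact: orthoC.
apply: centsuppM; last by apply: Kw'; exact: IH.
apply: Kp; have [i ->] := genp _ kx0; have [j ->] := genp _ ky0.
exact: centsupp_meet_zexpg.
Qed.

Lemma ortho_zexpg x p i : ortho x p -> ortho x (zexpg p i).
Proof. by move=> h; apply/ortho_link; apply: zexpg_within; exact/ortho_link. Qed.

Lemma ortho_prod (I : eqType) (r : seq I) (P : pred I) (F : I -> G) x :
  (forall i, i \in r -> P i -> ortho x (F i)) -> ortho x (\prod_(i <- r | P i) F i).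
Proof.
move=> h; rewrite big_seq_cond.
elim/big_ind: _ => [|y z|i /andP[ri Pi]]; [exact: ortho1|exact: orthoM|exact: h].
Qed.

(** A factor is orthogonal to the product of the others; if the total product is 1, it is the
    inverse of that product, so it is orthogonal to itself and trivial. *)
Lemma ortho_family_free n (p : 'I_n -> G) (m : 'I_n -> int) :
  (forall i, p i <> 1) -> (forall i, cycred (p i)) ->
  (forall i j, i <> j -> ortho (p i) (p j)) ->
  \prod_(i < n) zexpg (p i) (m i) = 1 -> forall i, m i = Posz 0.
Proof.
move=> p1 crp op prod1.
have all1 : forall r, uniq r -> \prod_(i <- r) zexpg (p i) (m i) = 1 ->
    forall i, i \in r -> zexpg (p i) (m i) = 1.
  elim=> //= i r IH /andP[ir ur]; rewrite big_cons => e.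
  have o : ortho (zexpg (p i) (m i)) (\prod_(j <- r) zexpg (p j) (m j)).
    apply: ortho_prod => j jr _; apply: ortho_zexpg; apply: orthoC; apply: ortho_zexpg.
    by apply: op => ji; move: ir; rewrite -ji jr.
  have i1 : zexpg (p i) (m i) = 1.
    apply: (@ortho_refl _ _ hG);
      rewrite -{2}(mulgK (\prod_(j <- r) zexpg (p j) (m j)) (zexpg _ _)).
    by rewrite e mul1g; exact: orthoV.
  rewrite i1 mul1g in e => j; rewrite in_cons => /orP[/eqP ->//|jr].
  exact: IH.
move=> i; have zi : zexpg (p i) (m i) = 1.
  by apply: (all1 (index_enum 'I_n)); rewrite ?index_enum_uniq ?mem_index_enum.
have := len_zexpg (m i) (crp i); rewrite zi (len1 hG) => /esym/eqP.
rewrite muln_eq0 => /orP[|/eqP/(len_eq0 hG)/(p1 i)//].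
by rewrite absz_eq0 => /eqP.
Qed.

End Primitive.

(** * Presentations, free Abelian groups and direct products *)

Section Presentations.
Variable G : groupType.
Implicit Types (A B H P : set G) (a x y z : G) (c d : (G * bool)%type) (u v : word G).

Lemma pres_eq_eval A u v :
  pres_eq A (commutation_relators A) u v -> eval_word u = eval_word v.
Proof.
elim=> {u v} [//|u v _ ->//|u v t _ -> _ ->//|u s b v _|u r v [s [t [_ _ _ st ->]]]].
  rewrite !eval_cat; congr (_ * _).
  by rewrite (eval_cons (s, b)) (eval_cons (linv (s, b))) eval_nil lvalV mulg1 mulgV mul1g.
rewrite !eval_cat; congr (_ * _); rewrite !eval_cons eval_nil /lval /= mulg1.
by rewrite st !mulgA mulgVK mulVg mul1g.
Qed.

Lemma is_raagI H A : (forall s, A s -> ~ A s^-1) -> H = generated A ->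
  (forall u, word_over A u -> eval_word u = 1 ->
     pres_eq A (commutation_relators A) u [::]) -> is_raag H A.
Proof.
move=> h1 h2 h3; split=> //; split=> // u Au; split; first exact: h3.
by move=> /pres_eq_eval; rewrite eval_nil.
Qed.

(** [pres_eq_swap] needs distinct generators; over a single generator the letters are equal, or they
    cancel in either order. *)
Lemma pres_eq_swap_commute A c d u : A c.1 -> A d.1 -> commute c.1 d.1 ->
  pres_eq A (commutation_relators A) (c :: d :: u) (d :: c :: u).
Proof.
move=> Ac Ad ccd; have [cd|/eqP cd] := eqVneq c.1 d.1; last exact: pres_eq_swap.
have [->|ncd] := eqVneq c d; first exact: pres_refl.
have -> : d = linv c.
  case: c d cd ncd {Ac Ad ccd} => [s b] [t b'] /= <-; rewrite xpair_eqE eqxx /linv /=.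
  by case: b b' => [] [].
exact: pres_trans (pres_eq_linv _ _ Ac) (pres_sym (pres_eq_linvl _ _ Ac)).
Qed.

Lemma pres_eq_move A c u v : A c.1 -> word_over A u ->
  (forall d, d \in u -> commute c.1 d.1) ->
  pres_eq A (commutation_relators A) (c :: u ++ v) (u ++ c :: v).
Proof.
move=> Ac; elim: u => [_ _|d u IH Adu cdu] /=; first exact: pres_refl.
apply: (@pres_trans _ _ _ _ (d :: c :: u ++ v)).
  by apply: pres_eq_swap_commute => //; [apply: Adu|apply: cdu]; rewrite mem_head.
apply: pres_eq_cons; apply: IH => e eu; [apply: Adu|apply: cdu];
  by rewrite in_cons eu orbT.
Qed.

Lemma pres_eq_sub A B u v : A `<=` B ->
  pres_eq A (commutation_relators A) u v -> pres_eq B (commutation_relators B) u v.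
Proof.
move=> AB; elim=> {u v} [u|u v _|u v t _ h1 _|u s b v As|u r v [s [t [As At st cst ->]]]].
- exact: pres_refl.
- exact: pres_sym.
- exact: pres_trans.
- by apply: pres_cancel; exact: AB.
- by apply: pres_relator; exists s, t; split=> //; exact: AB.
Qed.

Lemma generated_min A H : is_subgroup H -> A `<=` H -> generated A `<=` H.
Proof. exact: smallest_sub. Qed.

Lemma generated_mono A B : A `<=` B -> generated A `<=` generated B.
Proof.
move=> AB; apply: generated_min; first exact: generated_subgroup.
by move=> x /AB; exact: generated_sub.
Qed.

Lemma generated_eval A u : word_over A u -> generated A (eval_word u).
Proof.
have [h1 hM hV] := generated_subgroup A.
elim: u => [_|c u IH Acu]; first by rewrite eval_nil.
rewrite eval_cons; apply: hM.
  have Ac : generated A c.1 by apply: generated_sub; apply: Acu; rewrite mem_head.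
  by rewrite /lval; case: c.2 => //; exact: hV.
by apply: IH => d du; apply: Acu; rewrite in_cons du orbT.
Qed.

(** Freeness excludes [s = s^-1], by the exponent 2, and two mutually inverse basis elements, by the
    exponents 1 and 1. In a word of value 1 it makes each generator occur equally often with either
    sign, so the head can be moved next to an inverse letter and cancelled. *)
Lemma free_abelian_raag H P : is_free_abelian H P -> is_raag H P.
Proof.
move=> [HP cH indP]; have PH x : P x -> H x by rewrite HP; exact: generated_sub.
have comP x y : P x -> P y -> commute x y by move=> Px Py; apply: cH; exact: PH.
apply: is_raagI => //.
  move=> s Ps PV; have [sV|/eqP sV] := eqVneq s s^-1.
    have e : \prod_(i < 1) zexpg s (Posz 2) = 1.
      by rewrite big_ord1 /= expg2 {2}sV mulgV.
    have inj : injective (fun _ : 'I_1 => s) by move=> i j _; rewrite [i]ord1 [j]ord1.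
    by have := indP 1%N (fun=> s) (fun=> Posz 2) inj (fun=> Ps) e ord0.
  pose f (i : 'I_2) := if i == ord0 then s else s^-1.
  have e : \prod_(i < 2) zexpg (f i) (Posz 1) = 1.
    by rewrite big_ord_recl big_ord1 /f /= mulgV.
  have inj : injective f.
    move=> [[|[|//]] ?] [[|[|//]] ?]; rewrite /f /= => k; by [exact: val_inj|case: sV].
  have Pf i : P (f i) by rewrite /f; case: ifP.
  by have := indP 2%N f (fun=> Posz 1) inj Pf e ord0.
have bal u : word_over P u -> eval_word u = 1 ->
    forall s, count_mem (s, false) u = count_mem (s, true) u.
  move=> Pu u1; pose F u s := s ^+ count_mem (s, false) u * s ^- count_mem (s, true) u.
  (* The list [ps] may exceed the generators of [v], so that it stays fixed while [v] shrinks. *)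
  have FE ps v : uniq ps -> {subset map fst v <= ps} -> word_over P v ->
      (forall s, s \in ps -> P s) -> eval_word v = \prod_(s <- ps) F v s.
    move=> ups + + Pps; elim: v => [_ _|c v IH vps Pcv].
      by rewrite eval_nil big1_seq // => s _; rewrite /F /= !expg0 mulgV.
    rewrite eval_cons IH; last 2 first.
    - by move=> s sv; apply: vps; rewrite /= in_cons sv orbT.
    - by move=> d dv; apply: Pcv; rewrite in_cons dv orbT.
    pose E s := if s == c.1 then lval c else 1.
    have cps : c.1 \in ps by apply: vps; rewrite /= mem_head.
    have -> : lval c = \prod_(s <- ps) E s.
      by rewrite /E -big_mkcond /= -big_filter filter_pred1_uniq // big_seq1.
    have comE s t k : P s -> P t -> commute (E s) (t ^+ k).
      move=> Ps Pt; rewrite /E; case: eqP => [sc|_]; last exact/commute_sym/commute1.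
      apply: commuteX; rewrite /lval -sc; case: c.2; last exact: comP.
      by apply/commute_sym/commuteV; exact: comP.
    rewrite big_seq [X in _ * X]big_seq -prodgM_commute; last first.
      move=> s t sps tps; rewrite /F.
      by apply: commuteM; [|apply: commuteV]; apply: comE; exact: Pps.
    rewrite [RHS]big_seq; apply: eq_bigr => s sps; rewrite /F /E /=.
    case: c {cps vps Pcv E comE} => c [] /=;
      rewrite /lval !xpair_eqE /= andbF andbT add0n eq_sym.
      case: eqP => [->|_]; rewrite ?mul1g ?add0n // add1n expgSr invgM !mulgA;
        congr (_ * _).
      exact: (commute_sym (commuteV (commute_sym (commuteX _ (commute_refl s))))).
    by case: eqP => [->|_]; rewrite ?mul1g ?add0n // add1n expgS !mulgA.
  move=> s; pose ps := undup (map fst u).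
  have Pps t : t \in ps -> P t by rewrite mem_undup => /mapP[c /Pu + ->].
  have [sps|nps] := boolP (s \in ps); last first.
    rewrite !(count_memPn _) //; apply: contra nps => h; rewrite mem_undup.
      by apply/mapP; exists (s, true).
    by apply/mapP; exists (s, false).
  have [m mE] := choice (fun t => let: ex_intro2 i e k :=
    zexpg_quot t (count_mem (t, false) u)
     (count_mem (t, true) u) in ex_intro (fun i => F u t = zexpg t i /\ (i = Posz 0 ->
       _)) i (conj e k)).
  pose p (i : 'I_(size ps)) := nth 1 ps i.
  have pE : \prod_(i < size ps) zexpg (p i) (m (p i)) = 1.
    transitivity (eval_word u) => //; rewrite (FE ps u) ?undup_uniq //;
      last by move=> t; rewrite mem_undup.
    rewrite (big_nth 1) big_mkord; apply: eq_bigr => i _.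
    by rewrite -(mE _).1.
  have si : (index s ps < size ps)%N by rewrite index_mem.
  have := indP _ p (fun i => m (p i)) _ _ pE (Ordinal si).
  rewrite /p /= nth_index // => h; apply: (mE s).2; apply: h.
    by move=> i j /eqP; rewrite /p nth_uniq ?undup_uniq // => /eqP/val_inj.
  by move=> i; apply: Pps; exact: mem_nth.
move=> u; have [n] := ubnP (size u); elim: n u => // n IH [|c u] un Pcu u1.
  exact: pres_refl.
have Pc : P c.1 by apply: Pcu; rewrite mem_head.
have Vu : linv c \in u.
  have : linv c \in c :: u.
    have cc : (0 < count_mem c (c :: u))%N by rewrite -has_count has_pred1 mem_head.
    have := bal _ Pcu u1 c.1; rewrite -has_pred1 has_count.
    by case: c cc {Pcu u1 Pc un} => s [] /= h e; rewrite /linv /=; [rewrite e|rewrite -e].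
  by rewrite in_cons linv_neq.
case/splitPr: Vu un Pcu u1 => u1 u2 un Pcu e.
have Pu1 : word_over P u1 by move=> d du; apply: Pcu; rewrite in_cons mem_cat du orbT.
have step : pres_eq P (commutation_relators P) (c :: u1 ++ linv c :: u2) (u1 ++ u2).
  apply: (@pres_trans _ _ _ _ (u1 ++ c :: linv c :: u2)).
    by apply: pres_eq_move => // d /Pu1; exact: comP.
  by apply: pres_eq_cat; [exact: pres_refl|exact: pres_eq_linv].
apply: (pres_trans step); apply: IH.
- by move: un; rewrite /= !size_cat /=; lia.
- by move=> d; rewrite mem_cat => du; apply: Pcu; rewrite in_cons mem_cat in_cons;
    case/orP: du => ->; rewrite !orbT.
- by rewrite -(pres_eq_eval step).
Qed.

(** A word is sorted into a part over [P] and a part over [Q], and the trivial intersection makes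
    each part a relation of its own factor. An element of [P] inverse to one of [Q] would lie in
    both factors and be 1, which [is_raag] forbids. *)
Lemma direct_product_raag H A B P Q : is_raag A P -> is_raag B Q ->
  is_direct_product H A B -> is_raag H (P `|` Q).
Proof.
move=> [PV [AP presP]] [QV [BQ presQ]] [[sA sB] cAB AB1 HAB].
have PA x : P x -> A x by rewrite AP; exact: generated_sub.
have QB x : Q x -> B x by rewrite BQ; exact: generated_sub.
have [A1 AM AV] := sA; have [B1 BM BV] := sB.
have AB x : A x -> B x -> x = 1 by move=> Ax Bx; have : (A `&` B) x by []; rewrite AB1.
have P1 : ~ P 1 by move=> h; apply: (PV 1); rewrite ?invg1.
have Q1 : ~ Q 1 by move=> h; apply: (QV 1); rewrite ?invg1.
apply: is_raagI.
- move=> s [Ps|Qs] [Psv|Qsv].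
  + exact: PV Ps Psv.
  + by apply: P1; rewrite -(AB s) //; [exact: PA|rewrite -(invgK s); apply: BV;
    exact: QB].
  + by apply: Q1; rewrite -(AB s) //; [rewrite -(invgK s); apply: AV;
    exact: PA|exact: QB].
  + exact: QV Qs Qsv.
- have [g1 gM gV] := generated_subgroup (P `|` Q).
  rewrite HAB; apply/seteqP; split.
    move=> _ [x Ax [y By <-]]; apply: gM.
      by move: Ax; rewrite AP; apply: generated_mono; left.
    by move: By; rewrite BQ; apply: generated_mono; right.
  apply: generated_min; last first.
    by move=> s [/PA As|/QB Bs]; [exists s => //; exists 1|exists 1 => //; exists s];
      rewrite ?mulg1 ?mul1g.
  split; first by exists 1 => //; exists 1; rewrite ?mulg1.
    move=> _ _ [x Ax [y By <-]] [x' Ax' [y' By' <-]].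
    exists (x * x'); first exact: AM.
    exists (y * y'); first exact: BM.
    by rewrite -!mulgA; congr (_ * _); rewrite !mulgA (cAB x' y).
  move=> _ [x Ax [y By <-]]; exists x^-1; first exact: AV.
  by exists y^-1; [exact: BV|rewrite -invgM -(cAB x y)].
move=> u Uu u1.
have [uA [uB [e PuA QuB]]] : exists uA uB,
    [/\ pres_eq (P `|` Q) (commutation_relators (P `|` Q)) u (uA ++ uB),
        word_over P uA & word_over Q uB].
  elim: u Uu {u1} => [_|c u IH Ucu].
    by exists [::], [::]; split=> //; exact: pres_refl.
  have [|uA [uB [e PuA QuB]]] := IH; first by move=> d du; apply: Ucu;
    rewrite in_cons du orbT.
  have e' := pres_eq_cons c e.
  case: (Ucu c (mem_head _ _)) => [Pc|Qc].
    by exists (c :: uA), uB; split=> //; exact: word_over_cons.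
  exists uA, (c :: uB); split=> //; last exact: word_over_cons.
  apply: pres_trans e' _; apply: pres_eq_move; first by right.
    by move=> d /PuA; left.
  by move=> d /PuA /PA Ad; apply: commute_sym; apply: cAB => //; exact: QB.
have := pres_eq_eval e; rewrite u1 eval_cat => /esym e1.
have Aa : A (eval_word uA) by rewrite AP; exact: generated_eval.
have Bb : B (eval_word uB) by rewrite BQ; exact: generated_eval.
have a1 : eval_word uA = 1.
  apply: AB => //; have -> : eval_word uA = (eval_word uB)^-1.
    by apply: (@mulIg _ (eval_word uB)); rewrite mulVg.
  exact: BV.
have b1 : eval_word uB = 1 by move: e1; rewrite a1 mul1g.
apply: pres_trans e _; rewrite -[X in pres_eq _ _ _ X]/([::] ++ [::]).
by apply: pres_eq_cat; [apply: (@pres_eq_sub P); [left|exact/presP]|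
  apply: (@pres_eq_sub Q); [right|exact/presQ]].
Qed.

(** * Transport by conjugation *)

Lemma conj_setE a A : conj_set a A = [set z | A (z ^ a)].
Proof.
apply/seteqP; split=> [_ [s As <-]|z Az] /=.
  by rewrite conjgE mulgVK mulKg.
by exists (z ^ a) => //; rewrite conjgE mulVKg mulgK.
Qed.

Lemma conj_subgroup a H : is_subgroup H -> is_subgroup (conj_set a H).
Proof.
move=> [h1 hM hV]; rewrite conj_setE; split=> /=.
- by rewrite conj1g.
- by move=> x y hx hy; rewrite conjMg; exact: hM.
- by move=> x hx; rewrite conjVg; exact: hV.
Qed.

Lemma conj_generated a A : generated (conj_set a A) = conj_set a (generated A).
Proof.
apply/seteqP; split.
  apply: generated_min; first exact/conj_subgroup/generated_subgroup.
  by rewrite !conj_setE => x /= h; apply: (generated_sub h).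
have : generated A `<=` conj_set a^-1 (generated (conj_set a A)).
  apply: generated_min; first exact/conj_subgroup/generated_subgroup.
  move=> x Ax; rewrite conj_setE; apply: generated_sub.
  by rewrite conj_setE /= conjgKV.
by rewrite !(conj_setE _ (generated _)) => h x /h /=; rewrite conjgK.
Qed.

Lemma conj_raag a H A : is_raag H A -> is_raag (conj_set a H) (conj_set a A).
Proof.
move=> [AV [HA pres]]; apply: is_raagI.
- by rewrite conj_setE => s /=; rewrite conjVg; exact: AV.
- by rewrite conj_generated HA.
pose f b (c : G * bool) : G * bool := (c.1 ^ b, c.2).
have lvalf b c : lval (f b c) = lval c ^ b.
  by case: c => s []; rewrite /lval /f /= ?conjVg.
have evalf b u : eval_word (map (f b) u) = eval_word u ^ b.
  elim: u => [|c u IH]; first by rewrite /= eval_nil conj1g.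
  by rewrite /= !eval_cons IH lvalf conjMg.
have AE s : A s -> conj_set a A (s ^ a^-1) by rewrite conj_setE /= conjgKV.
have presf u v : pres_eq A (commutation_relators A) u v ->
    pres_eq (conj_set a A) (commutation_relators (conj_set a A))
      (map (f a^-1) u) (map (f a^-1) v).
  elim=> {u v} [u|u v _|u v t _ h1 _|u s b v As|u r v [s [t [As At st cst ->]]]].
  - exact: pres_refl.
  - exact: pres_sym.
  - exact: pres_trans.
  - by rewrite !map_cat; apply: pres_cancel; exact: AE.
  - rewrite !map_cat; apply: pres_relator; exists (s ^ a^-1), (t ^ a^-1).
    split=> //; [exact: AE|exact: AE|by move/conjg_inj|].
    by rewrite /commute -!conjMg cst.
move=> u Au u1; have uE : u = map (f a^-1) (map (f a) u).
  by rewrite -map_comp map_id_in // => -[s b] _; rewrite /f /= conjgK.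
rewrite uE; apply: (presf _ [::]); apply/pres; last by rewrite evalf u1 conj1g.
by move=> _ /mapP[c cu ->] /=; have := Au c cu; rewrite conj_setE.
Qed.

Lemma conj_free_abelian a H P :
  is_free_abelian H P -> is_free_abelian (conj_set a H) (conj_set a P).
Proof.
move=> [HP cH indP]; split; first by rewrite conj_generated HP.
  move=> x y; rewrite conj_setE => /= hx hy; apply: (@conjg_inj _ a).
  by rewrite !conjMg; exact: cH.
move=> n p m injp Pp p1; apply: (indP n (fun i => p i ^ a) m).
- by move=> i j /conjg_inj /injp.
- by move=> i; have := Pp i; rewrite conj_setE.
- transitivity ((\prod_(i < n) zexpg (p i) (m i)) ^ a); last by rewrite p1 conj1g.
  by rewrite conjg_prod; apply: eq_bigr => i _; rewrite conj_zexpg.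
Qed.

Lemma conj_direct_product a H A B : is_direct_product H A B ->
  is_direct_product (conj_set a H) (conj_set a A) (conj_set a B).
Proof.
move=> [[sA sB] cAB AB1 HAB]; split.
- by split; exact: conj_subgroup.
- move=> x y; rewrite !conj_setE /= => hx hy; apply: (@conjg_inj _ a).
  by rewrite !conjMg; exact: cAB.
- apply/seteqP; split=> x; rewrite !conj_setE /=.
    move=> h; have : (A `&` B) (x ^ a) by [].
    by rewrite AB1 /= => /eqP; rewrite conjg_eq1 => /eqP.
  by move=> ->; rewrite conj1g; case: sA => ? _ _; case: sB.
- rewrite HAB; apply/seteqP; split=> x.
    rewrite conj_setE => -[y Ay [z Bz e]].
    exists (y ^ a^-1); first by rewrite conj_setE /= conjgKV.
    exists (z ^ a^-1); first by rewrite conj_setE /= conjgKV.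
    by rewrite -conjMg e conjgK.
  move=> [y + [z + <-]]; rewrite !conj_setE /= => Ay Bz.
  by exists (y ^ a) => //; exists (z ^ a) => //; rewrite conjMg.
Qed.

End Presentations.

(** * The three parts of the theorem *)

Section Main.
Variables (G : groupType) (S : set G).
Hypothesis hG : is_raag [set: G] S.
Implicit Types (c d : (G * bool)%type) (u v w x y z g p q s t a : G) (A B : set G) (m n : nat).

Local Notation pre := (prec S).
Local Notation rw := (rw hG).
Local Notation geod := (geod hG).
Local Notation starts := (starts hG).
Local Notation indep_all := (indep_all hG).
Local Notation ortho := (ortho hG).
Local Notation within := (within hG).
Local Notation cycred := (cycred hG).
Local Notation supp := (supp hG).
Local Notation centsupp := (centsupp hG).
Local Notation prim_cycred := (prim_cycred hG).
Local Notation prim_factor := (prim_factor hG).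

(** Write [p = g * u * g^-1] without cancellation. If [g] is nontrivial, [cycred_conj_starts] for
    the power of [u] gives a first letter of [g^-1] that starts [u] or [u^-1] or is independent of
    [u], and each case creates a cancellation. This makes the factors of a decomposition cyclically
    reduced. *)
Lemma cycred_expI p m : (0 < m)%N -> cycred (p ^+ m) -> cycred p.
Proof.
move=> m0 crm; have [g [u [pE l cru]]] := conj_reduce hG p; rewrite pE in l.
have l1 := lenM hG g u; have l2 := lenM hG (g * u) g^-1.
have l3 := lenM hG u g^-1; have l4 := lenM hG g (u * g^-1).
rewrite (gmulA g) in l4; rewrite (lenV hG) in l2 l3.
have a1 : geod g u by apply/geodE; len_lia.
have a2 : geod u g^-1 by apply/geodE; rewrite (lenV hG); len_lia.
have a3 : geod g (u * g^-1) by apply/geodE; rewrite gmulA; len_lia.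
have pmE : p ^+ m = (u ^+ m) ^ g^-1.
  by rewrite conjXg conjgE invgK pE gmulA.
have [gV|/eqP gV] := eqVneq g^-1 1.
  have g1 : g = 1 by rewrite -(invgK g) gV invg1.
  by rewrite pE g1 invg1 mulg1 mul1g.
rewrite pmE in crm; have [c cg ccase] := cycred_conj_starts (cycredX cru) crm gV.
case: m m0 {pmE crm} ccase => // m _.
have um c' v : cycred v -> starts c' (v ^+ m.+1) -> starts c' v \/ indep_all c' v.
  by move=> crv; rewrite expgS => /(starts_split (cycred_geodX m crv)) [|[]];
    [left|right].
have ccase : [\/ starts c (u ^+ m.+1), starts c (u^-1 ^+ m.+1) | indep_all c (u ^+ m.+1)] ->
    [\/ starts c u, starts c u^-1 | indep_all c u].
  case=> [/um-/(_ cru)[]|/um-/(_ (cycredV cru))[]|/allP h];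
    try by [constructor 1|constructor 2|constructor 3].
    by rewrite indep_allV; constructor 3.
  constructor 3; apply/allP => e eu; apply: h; rewrite expgS mem_rw_geod ?eu //.
  exact: cycred_geodX.
rewrite -expVgn => /ccase [cu|cu|cu].
- by have /lcoprime_geodP/(_ c cg) := a1; rewrite cu.
- by have /lcoprime_geodP/(_ c cu) := a2; rewrite cg.
- have /lcoprime_geodP/(_ c cg) := a3.
  by rewrite (starts_indep cu cg a2).
Qed.

(** In [a = y * t], conjugation by [y] stays within the support of [p], and [t] then acts trivially.
    This allows the base point in [primitive] to be changed. *)
Lemma centsupp_conj p a z : cycred p -> cycred (p ^ a) -> centsupp p z ->
  centsupp (p ^ a) (z ^ a).
Proof.
move=> cr cra [cz iz]; split; first by rewrite /commute -!conjMg cz.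
have [y [t [aE ot ax _ i2]]] := conj_split cr cra.
apply: within_trans i2 _; rewrite aE conjgM; have iy : within (supp p) y := axial_supp ax.
have izy : within (supp p) (z ^ y).
  by rewrite conjgE; apply: withinM; [exact: withinV|exact: withinM].
have /ortho_commute c := ortho_supp izy ot.
by rewrite conjgE -c mulKg.
Qed.

Lemma primitiveP p : cycred p -> primitive S p <-> prim_cycred p.
Proof.
move=> cr; split=> [[p1 [a [/(X_cycredP hG) cra cyc]]]|[p1 _ gen]]; split=> //.
  move=> z /(centsupp_conj cr cra) /(Hsub_centsupp _ cra); rewrite cyc => -[n _ e].
  by exists n; apply: (@conjg_inj _ a); rewrite conj_zexpg.
exists 1; rewrite /is_cyclic_gen conjg1; split; first by apply/(X_cycredP hG);
  rewrite conjg1.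
apply/seteqP; split=> z.
  by move=> /(Hsub_centsupp z cr) /gen [n ->]; exists n.
by move=> [n _ <-]; apply/(Hsub_centsupp _ cr); exact: centsupp_zexpg.
Qed.

(** Only the component of [a] in the support of [q] can move [q]; the rest is orthogonal to [q].
    Hence orthogonality of the factors persists at all base points in X_w. *)
Lemma conj_prim_factor w a q : cycred w -> cycred (w ^ a) -> prim_factor w q ->
  within (supp q) (q ^ a).
Proof.
move=> cr cra [[_ crq _] [m [w' [m0 wE o]]]].
have [y [t [aE ot ax _ _]]] := conj_split cr cra.
have om : ortho (q ^+ m) w' by exact: orthoXl.
have iy : within (supp w) y := axial_supp ax; rewrite wE in iy ot.
have [y1 [y2 [yE i1 i2]]] := supp_split om iy.
have iq1 : within (supp q) y1.
  by apply: within_trans i1; apply: withinX; exact: within_supp.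
have iq : within (supp q) (q ^ y1).
  by rewrite conjgE; apply: withinM; [exact: withinV|apply: withinM => //;
    exact: within_supp].
have otq : ortho t q.
  apply: (ortho_supp (w := q ^+ m)); first exact: within_suppX.
  by apply: ortho_pre ot; apply: pre_geod; exact: ortho_geod.
have oy2 : ortho y2 q.
  by apply: orthoC; apply: ortho_supp i2 _.
rewrite aE yE !conjgM.
have /ortho_commute c2 := ortho_supp iq oy2; have /ortho_commute ct := ortho_supp iq otq.
by rewrite [_ ^ y2]conjgE -c2 mulKg conjgE -ct mulKg.
Qed.

Lemma prod_isolate n (p : 'I_n -> G) (F : 'I_n -> G) (r : seq 'I_n) i :
  (forall j k, j <> k -> ortho (p j) (F k)) ->
  (forall j k, j <> k -> commute (F j) (F k)) -> uniq r ->
  exists w', \prod_(j <- r) F j = (if i \in r then F i else 1) * w' /\ ortho (p i) w'.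
Proof.
move=> opF cF; elim: r => [_|j r IH /= /andP[jr ur]].
  by exists 1; rewrite big_nil mulg1; split=> //; exact: ortho1.
have [w' [rE o]] := IH ur; rewrite big_cons rE in_cons.
have [ij|/eqP ij] := eqVneq i j.
  by exists w'; rewrite ij (negbTE jr) mul1g; rewrite ij in o.
exists (F j * w'); split; last by apply: orthoM => //; exact: opF.
case: ifP => /= _; last by rewrite !mul1g.
by rewrite !gmulA (cF i j).
Qed.

(** A factor of a decomposition, once isolated, has the form required by [prim_factor]. Conversely
    all elements of [prim_factor w], listed once each with their exponents, make up a single
    decomposition. *)
Lemma Prim_prim_factor w : cycred w -> Prim S w = prim_factor w.
Proof.
move=> cr; apply/seteqP; split=> q.
  move=> [n [p [m [[wE pp m0 op] [i ->]]]]].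
  have oij j k : j <> k -> ortho (p j) (p k).
    move=> jk; apply/orthP; rewrite -(conjg1 (p j)) -(conjg1 (p k)); apply: op => //.
    by apply/(X_cycredP hG); rewrite conjg1.
  have oX j k : j <> k -> ortho (p j) (p k ^+ m k) by move=> jk; apply: orthoX;
    exact: oij.
  have cX j k : j <> k -> commute (p j ^+ m j) (p k ^+ m k).
    by move=> jk; apply: (@ortho_commute _ _ hG); apply: orthoXl; exact: oX.
  have [w' [e o]] := prod_isolate i oX cX (index_enum_uniq 'I_n).
  rewrite mem_index_enum -wE in e.
  have [crm _] : cycred (p i ^+ m i) /\ cycred w'.
    by apply: cycred_ortho; rewrite -?e //; exact: orthoXl.
  have cri := cycred_expI (m0 i) crm.
  by split; [exact/primitiveP|exists (m i), w'].
move=> fq.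
have [ps [wE hps hq us]] : exists ps : seq (G * nat),
    [/\ w = \prod_(e <- ps) e.1 ^+ e.2,
        forall e, e \in ps -> prim_factor w e.1 /\ (0 < e.2)%N,
        forall q, prim_factor w q -> q \in map fst ps & uniq (map fst ps)].
  move: w cr {q fq}; apply: prim_ind.
    by exists [::]; split=> // [|q /prim_factor1//]; rewrite big_nil.
  move=> w p m w' cr wE m0 pp o cr' [ps [wE' hps hq us]]; rewrite wE in cr *.
  exists ((p, m) :: ps); split=> /=.
  - by rewrite big_cons -wE'.
  - move=> e; rewrite in_cons => /orP[/eqP->|/hps[fe ?]]; split=> //=.
      by apply/prim_factor_mul => //; left.
    by apply/prim_factor_mul => //; right.
  - by move=> q /prim_factor_mul-/(_ cr m0 pp o) [->|/hq];
    rewrite in_cons ?eqxx // => ->; rewrite orbT.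
  (* If [p] were already listed as a factor of [w'], it would be orthogonal to itself. *)
  rewrite us andbT; apply/mapP => -[e /hps[fx _] px].
  case: pp => p1 _ _; apply: p1; apply: (@ortho_within_eq1 _ _ hG w').
    exact: o.
  by rewrite px; case: (prim_factor_centsupp fx).
have /mapP [x0 x0ps qx0] := hq q fq.
exists (size ps), (fun i : 'I__ => (nth x0 ps i).1), (fun i : 'I__ => (nth x0 ps i).2).
have nps (i : 'I_(size ps)) : nth x0 ps i \in ps by exact: mem_nth.
split; last first.
  have i0 : (index x0 ps < size ps)%N by rewrite index_mem.
  by exists (Ordinal i0); rewrite /= nth_index.
split.
- by rewrite {1}wE (big_nth x0) big_mkord.
- move=> i; have [fi _] := hps _ (nps i); have [[_ crp _] _] := fi.
  by apply/primitiveP => //; case: fi.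
- by move=> i; case: (hps _ (nps i)).
- move=> i j ij a /(X_cycredP hG) cra;
  have [[fi _] [fj _]] := (hps _ (nps i), hps _ (nps j)).
  apply/orthP; apply: ortho_within (conj_prim_factor cr cra fi) (conj_prim_factor cr cra fj).
  apply: prim_factor_ortho cr fi fj _ => e; apply: ij; apply: val_inj => /=.
  apply/eqP; rewrite -(nth_uniq x0.1 _ _ us) ?size_map //.
  by rewrite !(nth_map x0) // e.
Qed.

(* With m = x ∩ w^-1, x = m x' and w = w' m^-1, both x and w' are prefixes of
   w x = w' x' without common prefix, so x w' is a prefix of w' x' and m = 1. *)
Lemma tilde1P w x : cycred w -> tilde1 S w x <-> ortho x w.
Proof.
move=> cr; rewrite /tilde1 /simw /preceq /interval /= !mulg1 invg1 !mul1g.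
split=> [[/preE + ] h2|o]; last first.
  split; first by apply: pre_geod; apply: ortho_geod; apply: orthoC; apply: orthoV;
    exact: orthoC.
  by rewrite -(ortho_commute o); apply: pre_geod; exact: ortho_geod.
move=> /(_ hG); rewrite mulKg => /lcoprime_geodP; rewrite invgK => nxw.
have [m [x' [y' [xE wVE mx my n]]]] := ex_gcd hG x w^-1.
have wE : w = y'^-1 * m^-1 by rewrite -invgM -wVE invgK.
have aw : geod y'^-1 m^-1 by exact: geodV.
have wxE : w * x = y'^-1 * x' by rewrite wE {1}xE -gmulA mulKg.
have awx : geod y'^-1 x' by apply: lcoprime_geod; exact: lcoprimeC.
have p1 : pre y'^-1 (w * x) by rewrite wxE; exact: pre_geod.
have p2 : pre y'^-1 w by rewrite wE; exact: pre_geod.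
have [o pxw] := pre_lcoprime_ortho h2 p1 (lcoprime_pre nxw p2).
have l1 := pre_len pxw; rewrite wxE in l1.
have /geodE l2 := ortho_geod o; have /geodE l3 := awx; have /geodE l4 := mx.
rewrite -xE in l4.
have m1 : m = 1 by apply: (len_eq0 hG); len_lia.
by rewrite wE m1 invg1 mulg1.
Qed.

(** * Subgroups generated by sets of generators *)

Lemma generated_within A : A `<=` S -> generated A = [set x | within A x].
Proof.
move=> AS; apply/seteqP; split=> x.
  apply: generated_min; first by split; [exact: within1|exact: withinM|exact: withinV].
  move=> s As d; rewrite (teq_mem (rw_lval (c := (s, false)) hG (AS _ As))) inE.
  by move=> /eqP ->.
by move=> ix; rewrite -(rw_eval hG x); apply: generated_eval.
Qed.

Lemma sub_raag A : A `<=` S -> is_raag (generated A) A.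
Proof.
move=> AS; have [SV _] := hG; apply: is_raagI => // [s /AS Ss /AS|u Au u1].
  exact: SV.
have h := pres_eq_reduce_self Au.
have t : teq (reduce [::] u) [::].
  apply: (reduced_unique hG) => //; last by rewrite reduce_eval u1 mul1g.
    by move=> d /(reduce_over Au) /AS.
  exact: reduce_red.
by rewrite (size0nil (teq_size t)) in h.
Qed.

Lemma mem_rw_gen s : S s -> rw s =i [:: (s, false)].
Proof. by move=> Ss; exact: (teq_mem (rw_lval (c := (s, false)) hG Ss)). Qed.

Lemma cycred_gen s : S s -> cycred s.
Proof.
move=> Ss c /starts_mem; rewrite mem_rw_gen // inE => /eqP ->.
by apply/negP => /starts_mem; rewrite mem_rwV mem_rw_gen // inE linv_neq.
Qed.

Lemma gen_neq1 s : S s -> s <> 1.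
Proof. by move=> Ss s1; have := mem_rw_gen Ss (s, false); rewrite inE eqxx s1 rw1. Qed.

Lemma ortho_gen s x : S s -> (forall d, d \in rw x -> indep (s, false) d) -> ortho s x.
Proof. by move=> Ss h c d; rewrite mem_rw_gen // inE => /eqP ->; exact: h. Qed.

Lemma SorthP w : Sorth S w = [set s | S s /\ ortho s w].
Proof. by apply/seteqP; split=> s [Ss /orthP o]. Qed.

Lemma generated_Sorth w : generated (Sorth S w) = [set x | ortho x w].
Proof.
rewrite generated_within; last by move=> s [].
apply/seteqP; split=> x /= h.
  move=> c d cx dw; have := h c cx; rewrite SorthP => -[Sc oc].
  by apply: (oc (c.1, false) d) => //; rewrite mem_rw_gen // inE.
move=> c cx; rewrite SorthP; split; first exact: rw_over cx.
by apply: ortho_gen; [exact: rw_over cx|move=> d; exact: h c d cx].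
Qed.

Lemma centsupp_free_abelian w : cycred w -> is_free_abelian (centsupp w) (prim_factor w).
Proof.
move=> cr; split; first exact: centsupp_generated.
  by move=> x y; exact: centsupp_abelian.
move=> n p m injp Pp; apply: (ortho_family_free (hG := hG)).
- by move=> i; case: (Pp i) => -[].
- by move=> i; case: (Pp i) => -[].
- by move=> i j ij; apply: (prim_factor_ortho cr) => // /injp.
Qed.

Lemma HsubE w : cycred w -> Hsub S w = centsupp w.
Proof. by move=> cr; apply/seteqP; split=> x /(Hsub_centsupp _ cr). Qed.

Lemma Sorth_bigcap w : cycred w ->
  Sorth S w = S `&` \bigcap_(p in prim_factor w) Sorth S p.
Proof.
move=> cr; rewrite SorthP; apply/seteqP; split=> s.
  by move=> [Ss o]; split=> // p fp; rewrite SorthP; split=> //;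
    exact: (ortho_prim_factor s cr).1 o p fp.
move=> [Ss h]; split=> //; apply/(ortho_prim_factor s cr) => p /h.
by rewrite SorthP => -[].
Qed.

Lemma cyclically_reduced_case w : cycred w ->
  [/\ Sorth S w = S `&` \bigcap_(p in Prim S w) Sorth S p,
      tilde1 S w = generated (Sorth S w),
      tilde1 S w = \bigcap_(p in Prim S w) tilde1 S p,
      is_convex S (tilde1 S w) &
      [/\ is_median_subgroup S (Hsub S w),
          is_free_abelian (Hsub S w) (Prim S w) &
          Hsub S w `<=` center (centralizer w)]].
Proof.
move=> cr; rewrite Prim_prim_factor // HsubE //.
have t1 : tilde1 S w = generated (Sorth S w).
  by rewrite generated_Sorth; apply/seteqP; split=> x /(tilde1P _ cr).
split=> //; first exact: Sorth_bigcap.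
- apply/seteqP; split=> x.
    move=> /(tilde1P x cr) o p fp; have [[_ crp _] _] := fp.
    by apply/tilde1P => //; apply: (ortho_prim_factor x cr).1.
  move=> h; apply/(tilde1P x cr)/(ortho_prim_factor x cr) => p fp.
  by have [[_ crp _] _] := fp; apply/(tilde1P x crp); exact: h.
- by rewrite t1 generated_within; [exact: within_convex|move=> s []].
split; last 2 first.
- exact: centsupp_free_abelian.
- move=> z kz; split; first by case: kz.
  (* An element of H_w commutes with [y] because H_w is Abelian, and with [t] because their letters
     are independent. *)
  move=> x /(centralizer_split cr) [y [t [-> ky ot]]].
  apply: commuteM; first exact: centsupp_abelian kz ky.
  by apply: commute_sym; case: kz => _ iz; exact: ortho_commute (ortho_supp iz ot).
split; first exact: centsupp_subgroup.
move=> x y z kx ky kz; rewrite /median; apply: centsuppM => //.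
by apply: centsupp_meet => //; apply: centsuppM => //; exact: centsuppV.
Qed.

(** * Reduction to a cyclically reduced conjugate *)

Lemma conj_prim_decomposition w a n (p : 'I_n -> G) (m : 'I_n -> nat) :
  prim_decomposition S w p m ->
  prim_decomposition S (w ^ a) (fun i => p i ^ a) m.
Proof.
move=> [wE pp m0 op]; split=> //.
- by rewrite wE conjg_prod; apply: eq_bigr => i _; rewrite conjXg.
- move=> i; have [p1 [b [Xb cyc]]] := pp i.
  split; first by move=> /eqP; rewrite conjg_eq1 => /eqP.
  (* A base point [b] for [p i] becomes [a^-1 * b] for its conjugate. *)
  have e : (p i ^ a) ^ (a^-1 * b) = p i ^ b by rewrite -conjgM mulVKg.
  exists (a^-1 * b); rewrite e; split=> //.
  by apply/(X_cycredP hG); rewrite e; exact/X_cycredP.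
- move=> i j ij b /(X_cycredP hG); rewrite -!conjgM => Xb; apply: op => //.
  exact/X_cycredP.
Qed.

Lemma conj_Prim w a : Prim S w = conj_set a (Prim S (w ^ a)).
Proof.
have h v b q : Prim S v q -> Prim S (v ^ b) (q ^ b).
  move=> [n [p [m [dec [i ->]]]]]; exists n, (fun i => p i ^ b), m.
  by split; [exact: conj_prim_decomposition|exists i].
rewrite conj_setE; apply/seteqP; split=> q /=; first exact: h.
by move=> /(h _ a^-1); rewrite !conjgK.
Qed.

Lemma centralizer_product w : cycred w ->
  is_direct_product (centralizer w) (generated (Sorth S w)) (generated (prim_factor w)).
Proof.
move=> cr; split; first by split; exact: generated_subgroup.
- rewrite generated_Sorth -centsupp_generated // => x y ox_ [_ iy].
  exact: ortho_commute (ortho_supp iy ox_).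
- apply/seteqP; split=> x; rewrite generated_Sorth -centsupp_generated //.
    by move=> [/= o [_ i]]; exact: ortho_within_eq1 o i.
  by move=> ->; split; [apply: orthoC; exact: ortho1|exact: centsupp1].
rewrite generated_Sorth -centsupp_generated //; apply/seteqP; split=> x.
  move=> /(centralizer_split cr) [y [t [-> ky ot]]].
  exists t => //; exists y => //; case: ky => _ iy.
  exact: ortho_commute (ortho_supp iy ot).
move=> [t /= ot [y [cy _] <-]]; apply: commuteM => //.
exact: commute_sym (ortho_commute ot).
Qed.

Lemma general_case w a : X S w a ->
  let T := conj_set a S `&`
           \bigcap_(p in Prim S w) conj_set a (Sorth S (p ^ a)) in
  [/\ is_raag (generated T) T,
      is_free_abelian (generated (Prim S w)) (Prim S w),
      is_direct_product (centralizer w) (generated T) (generated (Prim S w)) &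
      exists U : set G, is_raag (centralizer w) U].
Proof.
move=> /(X_cycredP hG) cr T.
(* The factors of [w] are the conjugates of those of [w ^ a], so the intersection is that of the
   cyclically reduced case, transported by [a]. *)
have TE : T = conj_set a (Sorth S (w ^ a)).
  rewrite Sorth_bigcap // -Prim_prim_factor // /T (conj_Prim w a) !conj_setE.
  apply/seteqP; split=> z /= [Sz h]; split=> // q fq.
    by have := h (q ^ a^-1); rewrite /= conj_setE /= !conjgKV; apply.
  by rewrite conj_setE /=; exact: h.
have CE : centralizer w = conj_set a (centralizer (w ^ a)).
  rewrite /centralizer conj_setE; apply/seteqP; split=> z /=; rewrite /commute -!conjMg.
    by move=> ->.
  by move/conjg_inj.
have PE : Prim S w = conj_set a (prim_factor (w ^ a)) by rewrite (conj_Prim w a) Prim_prim_factor.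
have rT : is_raag (generated T) T.
  by rewrite TE conj_generated; apply/conj_raag/sub_raag => s [].
have fP : is_free_abelian (generated (Prim S w)) (Prim S w).
  rewrite PE conj_generated; apply: conj_free_abelian; rewrite -centsupp_generated //.
  exact: centsupp_free_abelian.
have dp : is_direct_product (centralizer w) (generated T) (generated (Prim S w)).
  rewrite CE TE PE !conj_generated; apply: conj_direct_product.
  exact: centralizer_product.
split=> //; exists (T `|` Prim S w).
by apply: direct_product_raag rT _ dp; exact: free_abelian_raag.
Qed.

(** A central [z] commutes with each generator [t]; splitting the centralizer of [t] shows that
    every letter of [z] is [t] up to sign or independent of [t]. Distinct commuting generators are
    orthogonal, which gives freeness. *)
Lemma center_free_abelian : is_free_abelian (center [set: G])
  [set s | S s /\ forall t, S t -> commute s t].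
Proof.
set C := [set s | _]; have CS : C `<=` S by move=> s [].
have [_ [genG _]] := hG; split.
- apply/seteqP; split=> z.
    move=> [_ cz]; rewrite generated_within // => c cz'; split; first exact: rw_over cz'.
    move=> t St; have [y [t' [zE [_ iy] ot]]] :=
      centralizer_split (cycred_gen St) (commute_sym (cz t I)).
    rewrite zE in cz'; have := mem_rwM cz'; rewrite mem_cat => /orP[/iy [b]|ct].
      by rewrite mem_rw_gen // inE => /eqP [-> _]; exact: commute_refl.
    have := ot c (t, false) ct; rewrite mem_rw_gen // inE eqxx => /(_ isT).
    by move=> /andP[_ /eqP].
  apply: generated_min.
    split; first by split=> // x _; apply/commute_sym/commute1.
      by move=> x y [_ cx] [_ cy]; split=> // t _; apply/commute_sym/commuteM;
        apply: commute_sym; [exact: cx|exact: cy].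
    by move=> x [_ cx]; split=> // t _; apply/commute_sym/commuteV/commute_sym/cx.
  move=> s [Ss cs]; split=> // x _.
  have : [set: G] x by []; rewrite genG; apply: generated_min => //.
  split; [exact: commute1|by move=> ? ?; exact: commuteM|by move=> ?; exact: commuteV].
- by move=> x y [_ cx] _; exact: cx.
move=> n p m injp Cp; apply: (ortho_family_free (hG := hG)).
- by move=> i; apply/gen_neq1/CS.
- by move=> i; apply/cycred_gen/CS.
move=> i j ij; apply: ortho_gen; first exact/CS.
move=> d; rewrite mem_rw_gen; last exact/CS.
rewrite inE => /eqP ->; apply/andP; split; first by apply/eqP => /injp.
by have [_ cs] := Cp i; apply/eqP/cs; exact: CS (Cp j).
Qed.

End Main.

Theorem corollary8p11 (G : groupType) (S : set G) (hG : is_raag [set: G] S) :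
  (forall w : G, cyclically_reduced S w ->
     [/\ Sorth S w = S `&` \bigcap_(p in Prim S w) Sorth S p,
         tilde1 S w = generated (Sorth S w),
         tilde1 S w = \bigcap_(p in Prim S w) tilde1 S p,
         is_convex S (tilde1 S w) &
         [/\ is_median_subgroup S (Hsub S w),
             is_free_abelian (Hsub S w) (Prim S w) &
             Hsub S w `<=` center (centralizer w)]])
  /\
  (forall w a : G, X S w a ->
     let T := conj_set a S `&`
              \bigcap_(p in Prim S w) conj_set a (Sorth S (p ^ a)) in
     [/\ is_raag (generated T) T,
         is_free_abelian (generated (Prim S w)) (Prim S w),
         is_direct_product (centralizer w) (generated T)
           (generated (Prim S w)) &
         exists U : set G, is_raag (centralizer w) U])
  /\
  is_free_abelian (center [set: G])
    [set s | S s /\ forall t, S t -> commute s t].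
Proof.
split; first by move=> w /(cycredP hG); exact: cyclically_reduced_case.
by split; [exact: general_case|exact: center_free_abelian].
Qed.
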